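(* There exists an absolute constant $\kappa>0$ such that for all $c\ge\kappa$, $p\in(0,2]$ and $\alpha>1/p-1/2$ there exists a constant $C>0$, depending only on $\alpha,p,c$, with the following property. For all integers $N\ge1$, $r\ge2$, with $n=2^N$, and all $R>0$ such that $n^\alpha>R$ and $nR^2\ge1$, the estimator $\tilde s$ computed with the NEH strategy (with constant $c$ in the penalty) satisfies $$\sup_{s\in\mathcal{P}(R,\alpha,p)}\mathbb{E}_s\|s-\tilde s\|^2\le C\inf_{\hat s}\sup_{s\in\mathcal{P}(R,\alpha,p)}\mathbb{E}_s\|s-\hat s\|^2,$$ where the infimum is taken over all estimators $\hat s$.
   Context: Model. $n=2^N$ with an integer $N\ge1$, and $r\ge2$ is an integer. $X_1,\dots,X_n$ are independent random column vectors, $X_i\in\{0,1\}^r$ with components summing to one. $X$ is the $r\times n$ random matrix with $i$th column $X_i$ and $s$ is its expectation (so each column of $s$ is a probability on $\{1,\dots,r\}$, and $s$ determines the law of $X$). $\mathbb{P}_s,\mathbb{E}_s$ denote probability and expectation when the mean of $X$ is $s$. An estimator is a function of $X$ with values in the $r\times n$ real matrices. For an $r\times n$ matrix $t$, $t^{(j)}$ is its $j$th line (a vector of $\mathbb{R}^n$), $t_i$ its $i$th column; $\langle t,t'\rangle=\sum_{i,j}t_i^{(j)}t_i'^{(j)}$ and $\|\cdot\|$ is the associated norm; $\langle\cdot,\cdot\rangle_q$ and $\|\cdot\|_q$ are the Euclidean inner product and norm of $\mathbb{R}^q$. For a linear subspace $S\subset\mathbb{R}^n$, $\mathbb{R}^r\otimes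 S$ is the set of $r\times n$ matrices all of whose lines belong to $S$. Haar basis. $\Lambda=\bigcup_{j=-1}^{N-1}\Lambda(j)$ where $\Lambda(-1)=\{(-1,0)\}$ and $\Lambda(j)=\{(j,k):k=0,\dots,2^j-1\}$ for $j\ge0$. Let $\varphi:\mathbb{R}\to\{-1,0,1\}$ equal $1$ on $(0,1/2]$, $-1$ on $(1/2,1]$ and $0$ elsewhere. For $\lambda\in\Lambda$, $\phi_\lambda\in\mathbb{R}^n$ has $i$th component $1/\sqrt n$ if $\lambda=(-1,0)$ and $\frac{2^{j/2}}{\sqrt n}\varphi\left(2^j\frac in-k\right)$ if $\lambda=(j,k)$ with $j\ge0$. $\{\phi_\lambda,\lambda\in\Lambda\}$ is an orthonormal basis of $\mathbb{R}^n$. Class $\mathcal{P}(R,\alpha,p)$. For an $r\times n$ matrix $t$, let $\beta_\lambda\in\mathbb{R}^r$ have components $\beta_\lambda^{(j)}=\langle t^{(j)},\phi_\lambda\rangle_n$, $j=1,\dots,r$. For $R>0$, $p\in(0,2]$, $\alpha>1/p-1/2$, $\mathcal{P}(R,\alpha,p)$ is the set of $r\times n$ matrices $t$ whose columns are all probabilities on $\{1,\dots,r\}$ and such that $\sum_{j=0}^{N-1}2^{jp(\alpha+1/2-1/p)}\sum_{\lambda\in\Lambda(j)}\|\beta_\lambda\|_r^p\le n^{p/2}R^p$. Penalized estimator. Given a finite collection $\{S_m,m\in\mathcal{M}\}$ of linear subspaces of $\mathbb{R}^n$ with $D_m=\dim S_m$ and a penalty $\mathrm{pen}:\mathcal{M}\to\mathbb{R}_+$,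 $\hat s_m$ is the orthogonal projection of $X$ onto $\mathbb{R}^r\otimes S_m$, $\gamma_n(t)=\|t\|^2-2\langle X,t\rangle$, and $\tilde s=\hat s_{\hat m}$ where $\hat m$ minimizes $\gamma_n(\hat s_m)+\mathrm{pen}(m)$ over $m\in\mathcal{M}$. NEH strategy. For $J\in\{0,\dots,N-1\}$, $\mathcal{M}_J$ is the collection of all subsets $m\subset\Lambda$ of the form $m=\left[\bigcup_{j=-1}^{J-1}\Lambda(j)\right]\cup\left[\bigcup_{k=0}^{N-J-1}\Lambda'(J+k)\right]$, where $\Lambda'(J+k)$ is any subset of $\Lambda(J+k)$ with cardinality $\lfloor2^J(k+1)^{-3}\rfloor$ ($\lfloor x\rfloor$ is the integer part of $x$). $\mathcal{M}=\bigcup_{J=0}^{N-1}\mathcal{M}_J$; $S_m$ is the linear span of $\{\phi_\lambda,\lambda\in m\}$, so $D_m=|m|$; and $\mathrm{pen}(m)=cD_m$. *)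

(* Defs.v *)
From HB Require Import structures.
From mathcomp Require Import all_boot all_order all_algebra.
From mathcomp Require Import all_classical all_reals all_analysis.

Set Implicit Arguments.
Unset Strict Implicit.
Unset Printing Implicit Defensive.

Import Order.TTheory GRing.Theory Num.Theory.
Import numFieldNormedType.Exports.

Local Open Scope classical_set_scope.
Local Open Scope ring_scope.

(* Entrywise Euclidean inner product and norm.  On 'rV[R]_q these are the inner
   product and norm of R^q; the norm `|_| that MathComp-Analysis puts on
   matrices is the sup norm. *)
Definition mxdot (R : realType) (p q : nat) (t t' : 'M[R]_(p, q)) : R :=
  \sum_(i < p) \sum_(j < q) t i j * t' i j.

Definition mxnorm (R : realType) (p q : nat) (t : 'M[R]_(p, q)) : R :=
  Num.sqrt (mxdot t t).

Definition prob_columns (R : realType) (r n : nat) (t : 'M[R]_(r, n)) : Prop :=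
  (forall j i, 0 <= t j i) /\ (forall i, \sum_(j < r) t j i = 1).

Definition observation (R : realType) (r n : nat) (x : 'M[R]_(r, n)) : Prop :=
  (forall j i, x j i = 0 \/ x j i = 1) /\ (forall i, \sum_(j < r) x j i = 1).

(* X has independent columns in {0,1}^r summing to one, and mean s, under P.
   The columns take finitely many values, so in the product rule the sets A i
   may be arbitrary; subfamilies are covered by taking A i := setT. *)
Record multinomial_model (R : realType) (d : measure_display)
    (Omega : measurableType d) (r n : nat) (P : probability Omega R)
    (X : Omega -> 'M[R]_(r, n)) (s : 'M[R]_(r, n)) : Prop := {
  model_measurable : forall j i, measurable_fun setT (fun w => X w j i) ;
  model_values : forall w, observation (X w) ;
  model_independent : forall A : 'I_n -> set 'cV[R]_r,
    P [set w | forall i, A i (col i (X w))] =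
    (\prod_(i < n) P [set w | A i (col i (X w))])%E ;
  model_mean : forall j i, 'E_P[fun w => X w j i]%E = (s j i)%:E }.

(* As X takes finitely many values, measurability of estimators is automatic. *)
Definition estimator (R : realType) (r n : nat) := 'M[R]_(r, n) -> 'M[R]_(r, n).

Definition risk (R : realType) (d : measure_display) (Omega : measurableType d)
    (r n : nat) (P : probability Omega R) (X : Omega -> 'M[R]_(r, n))
    (s : 'M[R]_(r, n)) (est : estimator R r n) : \bar R :=
  'E_P[fun w => (mxnorm (s - est (X w)) ^+ 2)%R]%E.

Definition max_risk (R : realType) (d : measure_display)
    (Omega : measurableType d) (r n : nat)
    (P : 'M[R]_(r, n) -> probability Omega R) (X : Omega -> 'M[R]_(r, n))
    (T : set 'M[R]_(r, n)) (est : estimator R r n) : \bar R :=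
  ereal_sup [set risk (P s) X s est | s in T].

Definition minimax_risk (R : realType) (d : measure_display)
    (Omega : measurableType d) (r n : nat)
    (P : 'M[R]_(r, n) -> probability Omega R) (X : Omega -> 'M[R]_(r, n))
    (T : set 'M[R]_(r, n)) : \bar R :=
  ereal_inf [set max_risk P X T est | est in [set: estimator R r n]].

(* None stands for (-1,0), Some (Tagged _ k) with k : 'I_(2 ^ j) for (j,k). *)
Definition Lambda (N : nat) : finType := option {j : 'I_N & 'I_(2 ^ j)}.

Definition Lambda_coarse (N : nat) : {set Lambda N} := [set None]%SET.

Definition Lambda_level (N j : nat) : {set Lambda N} :=
  [set l : Lambda N | if l is Some u then val (tag u) == j else false]%SET.

Definition haar_mother (R : realType) (x : R) : R :=
  if (0 < x) && (x <= 1 / 2) then 1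
  else if (1 / 2 < x) && (x <= 1) then -1 else 0.

(* Components are numbered from 1 in the formula, hence i.+1. *)
Definition haar (R : realType) (N : nat) (l : Lambda N) : 'rV[R]_(2 ^ N) :=
  let n : R := (2 ^ N)%:R in
  \row_(i < 2 ^ N)
    match l with
    | None => 1 / Num.sqrt n
    | Some u =>
        let j : nat := tag u in
        let k : nat := tagged u in
        2 `^ (j%:R / 2) / Num.sqrt n
        * haar_mother (2 ^+ j * (i.+1%:R / n) - k%:R)
    end.

Definition haar_coef (R : realType) (r N : nat) (t : 'M[R]_(r, 2 ^ N))
    (l : Lambda N) : 'rV[R]_r :=
  \row_(j < r) mxdot (row j t) (haar R l).

Definition besov_class (R : realType) (r N : nat) (rad alpha p : R) :
    set 'M[R]_(r, 2 ^ N) :=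
  [set t | prob_columns t /\
    \sum_(j < N) 2 `^ (j%:R * p * (alpha + 1 / 2 - 1 / p)) *
      (\sum_(l in Lambda_level N j) mxnorm (haar_coef t l) `^ p)
    <= (2 ^ N)%:R `^ (p / 2) * rad `^ p].

Definition lines_in (R : realType) (r n : nat) (S : {vspace 'rV[R]_n})
    (t : 'M[R]_(r, n)) : Prop :=
  forall j, row j t \in S.

Definition is_orth_proj (R : realType) (r n : nat) (S : {vspace 'rV[R]_n})
    (x t : 'M[R]_(r, n)) : Prop :=
  lines_in S t /\ forall u, lines_in S u -> mxdot (x - t) u = 0.

Definition contrast (R : realType) (r n : nat) (x t : 'M[R]_(r, n)) : R :=
  mxnorm t ^+ 2 - 2 * mxdot x t.

(* The minimizer m need not be unique: any choice of it, as a function of the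
   observation, is allowed. *)
Definition is_penalized_estimator (R : realType) (r n : nat) (I : Type)
    (M : set I) (S : I -> {vspace 'rV[R]_n}) (pen : I -> R)
    (est : estimator R r n) : Prop :=
  forall x, observation x ->
    exists m, M m /\ is_orth_proj (S m) x (est x) /\
      forall m' t', M m' -> is_orth_proj (S m') x t' ->
        contrast x (est x) + pen m <= contrast x t' + pen m'.

Definition haar_span (R : realType) (N : nat) (m : {set Lambda N}) :
    {vspace 'rV[R]_(2 ^ N)} :=
  <<[seq haar R l | l <- enum m]>>%VS.

(* %/ is Euclidean division, so the cardinality is the integer part of
   2^J (k+1)^(-3). *)
Definition NEH_models_at (N J : nat) : set {set Lambda N} :=
  [set m | exists L : 'I_(N - J) -> {set Lambda N},
    (forall k : 'I_(N - J), L k \subset Lambda_level N (J + k) /\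
       #|L k| = (2 ^ J %/ k.+1 ^ 3)%N) /\
    m = ((Lambda_coarse N :|: \bigcup_(j < J) Lambda_level N j)
         :|: \bigcup_(k < N - J) L k)%SET].

Definition NEH_models (N : nat) : set {set Lambda N} :=
  [set m | exists J, (J < N)%N /\ NEH_models_at J m].

Definition is_NEH_estimator (R : realType) (r N : nat) (c : R)
    (est : estimator R r (2 ^ N)) : Prop :=
  is_penalized_estimator (@NEH_models N) (@haar_span R N)
    (fun m => c * (\dim (haar_span R m))%:R) est.

(* Main.v *)
From HB Require Import structures.
Require Import Defs.
From mathcomp Require Import all_boot all_order all_algebra.
From mathcomp Require Import all_classical all_reals all_analysis.
From mathcomp Require Import measurable_realfun.
From mathcomp Require Import ring lra zify.
Import Order.TTheory GRing.Theory Num.Theory.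
Import numFieldNormedType.Exports.
Local Open Scope classical_set_scope.
Local Open Scope ring_scope.

Set Implicit Arguments.
Unset Strict Implicit.
Unset Printing Implicit Defensive.

(** Both sides of the inequality are of the order of 2^J, where J is the level at
    which the squared bias n rad^2 2^(-2 alpha J) and the variance 2^J balance.

    Upper bound. Comparing contrasts (penalized_error_le) bounds the squared error by
    a multiple of the squared bias and of c #|m|, for any fixed model m, plus the
    excess of the noise energy over the penalty, maximised over all the models.
    The mean of this excess is bounded (noise_sup_mean) for two reasons. First,
    the noise projected on a model m has an energy Z with E exp(Z/32) <=
    exp(#|m|/8), whatever r is (noise_exp_moment). Second, there are at most
    exp(10 * 2^J) models whose coarse part stops at level J, and each of them has
    dimension at least 2^J (NEH_union_bound), so that c #|m| dominates the entropy
    as soon as c >= 1536. Since the dimension of a model is at most 3 * 2^J, it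
    remains to approximate: keeping in level J + k only the 2^J / (k+1)^3 largest
    coefficients leaves a squared bias of order n rad^2 2^(-2 alpha J)
    (besov_approximation), the condition alpha > 1/p - 1/2 making the series
    over k converge.

    The exponential moment of Z is the probabilistic core. Z is a quadratic form
    <AS, S> in a sum S of independent centred vectors. The vectors are averaged
    out one at a time (quadratic_exp_moment): symmetrisation turns each of them
    into a random sign times a vector v, the bound
    (e^x + e^-x)/2 <= e^(2 x^2) replaces A by A + 8 (Av)(Av)^T, and the operators so
    obtained stay bounded because their inverses only lose 8 v v^T at each step.
    This is a Hanson-Wright inequality whose constants involve the trace and the
    operator norm of the projection only.

    Lower bound. The vectors (1/2, 1/2, 0, ...) perturbed by 1/4 of a set of wavelets
    of level J form a hypercube with 2^J bits inside the Besov body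
    (hypercube_besov); flipping a bit changes the squared norm by a constant and
    the law of X by a bounded chi-square divergence (chi2_factor), so every bit
    costs a constant (assouad).

    As X takes finitely many values, all means are finite sums over the words c
    that list the rows of the ones of X (risk_prod_mean). *)

(** * Exponential inequalities *)

Section ExpIneq.
Variable R : realType.
Implicit Types x y : R.

(** From exp(-x) >= 1 - x, by taking inverses. *)
Lemma expR_le_quad x : `|x| <= 1 / 2 -> expR x <= 1 + x + 2 * x ^+ 2.
Proof.
move=> hx.
have /ler_normlP[h1 h2] := hx.
have h := expR_ge1Dx (- x).
have hp := expR_gt0 x.
have e : expR x * expR (- x) = 1 by rewrite -expRD subrr expR0.
have hle : expR x * (1 - x) <= 1 by rewrite -[leRHS]e ler_pM2l.
have hq : 1 <= (1 + x + 2 * x ^+ 2) * (1 - x).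
  have -> : (1 + x + 2 * x ^+ 2) * (1 - x) = 1 + x ^+ 2 * (1 - 2 * x) by ring.
  rewrite lerDl mulr_ge0 ?sqr_ge0 //; lra.
rewrite -(ler_pM2r (_ : 0 < 1 - x)); last lra.
exact: le_trans hle hq.
Qed.

(** The subgaussian bound for a random sign, with the constant 2 where 1/2 is
    optimal: this is enough below and needs no power series. Near 0 the odd terms
    of the quadratic bound cancel; for |x| >= 1/2 one has |x| <= 2 x^2. *)
Lemma cosh_le_exp_sqr x : expR x + expR (- x) <= 2 * expR (2 * x ^+ 2).
Proof.
have [hx|hx] := leP `|x| (1 / 2).
  have h1 := expR_le_quad hx.
  have h2 : expR (- x) <= 1 - x + 2 * x ^+ 2.
    by have := @expR_le_quad (- x); rewrite normrN sqrrN => /(_ hx).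
  have h3 := expR_ge1Dx (2 * x ^+ 2).
  lra.
have hn : `|x| <= 2 * x ^+ 2.
  rewrite -(real_normK (num_real x)).
  have -> : 2 * `|x| ^+ 2 = `|x| * (2 * `|x|) by ring.
  rewrite -[X in X <= _]mulr1 ler_wpM2l //; lra.
have h1 : expR x <= expR (2 * x ^+ 2).
  by rewrite ler_expR (le_trans _ hn) // ler_norm.
have h2 : expR (- x) <= expR (2 * x ^+ 2).
  by rewrite ler_expR (le_trans _ hn) // -normrN ler_norm.
lra.
Qed.

(** The tangent of exp at the mean lies below exp. *)
Lemma expR_jensen (T : finType) (w u : T -> R) :
  (forall a, 0 <= w a) -> \sum_a w a = 1 ->
  expR (\sum_a w a * u a) <= \sum_a w a * expR (u a).
Proof.
move=> w0 w1; set m := \sum_a w a * u a.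
have h a : w a * (expR m * (1 + (u a - m))) <= w a * expR (u a).
  apply: ler_wpM2l => //.
  have -> : expR (u a) = expR m * expR (u a - m) by rewrite -expRD; congr expR; ring.
  by rewrite ler_pM2l ?expR_gt0 // expR_ge1Dx.
apply: le_trans (ler_sum _ (fun a _ => h a)).
have -> : \sum_a w a * (expR m * (1 + (u a - m))) =
   expR m * ((1 - m) * (\sum_a w a) + \sum_a w a * u a).
  rewrite mulrDr !mulr_sumr -big_split /=; apply: eq_bigr => a _; ring.
by rewrite w1 -/m mulr1 subrK mulr1.
Qed.

End ExpIneq.

(** * The entrywise inner product *)

Section Mxdot.
Variables (R : realType) (p q : nat).
Implicit Types (x y z : 'M[R]_(p, q)) (a : R).

Lemma mxdotC x y : mxdot x y = mxdot y x.
Proof. by apply: eq_bigr => i _; apply: eq_bigr => j _; rewrite mulrC. Qed.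

Lemma mxdotDl x y z : mxdot (x + y) z = mxdot x z + mxdot y z.
Proof.
rewrite /mxdot -big_split; apply: eq_bigr => i _ /=.
by rewrite -big_split; apply: eq_bigr => j _ /=; rewrite mxE mulrDl.
Qed.

Lemma mxdotZl a x z : mxdot (a *: x) z = a * mxdot x z.
Proof.
rewrite /mxdot mulr_sumr; apply: eq_bigr => i _ /=.
by rewrite mulr_sumr; apply: eq_bigr => j _ /=; rewrite mxE mulrA.
Qed.

Lemma mxdotDr x y z : mxdot x (y + z) = mxdot x y + mxdot x z.
Proof. by rewrite mxdotC mxdotDl !(mxdotC _ x). Qed.

Lemma mxdotZr a x z : mxdot x (a *: z) = a * mxdot x z.
Proof. by rewrite mxdotC mxdotZl (mxdotC z). Qed.

Lemma mxdotNl x y : mxdot (- x) y = - mxdot x y.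
Proof. by rewrite -scaleN1r mxdotZl mulN1r. Qed.

Lemma mxdotNr x y : mxdot x (- y) = - mxdot x y.
Proof. by rewrite mxdotC mxdotNl mxdotC. Qed.

Lemma mxdot0l x : mxdot 0 x = 0.
Proof. by rewrite -(scale0r x) mxdotZl mul0r. Qed.

Definition mxdotE := (mxdotDl, mxdotDr, mxdotZl, mxdotZr, mxdotNl, mxdotNr).

Lemma mxdot_suml (I : Type) (s : seq I) (P : pred I) (F : I -> 'M[R]_(p, q)) y :
  mxdot (\sum_(i <- s | P i) F i) y = \sum_(i <- s | P i) mxdot (F i) y.
Proof.
elim: s => [|i s IH]; first by rewrite !big_nil mxdot0l.
by rewrite !big_cons; case: (P i); rewrite // mxdotDl IH.
Qed.

Lemma mxdot_ge0 x : 0 <= mxdot x x.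
Proof.
by apply: sumr_ge0 => i _; apply: sumr_ge0 => j _; rewrite -expr2 sqr_ge0.
Qed.

Lemma mxnorm_sqr x : mxnorm x ^+ 2 = mxdot x x.
Proof. by rewrite /mxnorm sqr_sqrtr ?mxdot_ge0. Qed.

End Mxdot.

(** * Means under a finite product law *)

Section ProductExpectation.
Variable (R : realType).

(** The mean of F(c) when the coordinates c i are independent and c i = a has
    probability w i a. *)
Definition prod_mean n (T : finType) (w : 'I_n -> T -> R) (F : {ffun 'I_n -> T} -> R) : R :=
  \sum_(c : {ffun 'I_n -> T}) (\prod_(i < n) w i (c i)) * F c.

Definition fcons n (T : Type) (a : T) (c : {ffun 'I_n -> T}) : {ffun 'I_n.+1 -> T} :=
  [ffun i => if unlift ord0 i is Some j then c j else a].

Lemma fcons0 n T a (c : {ffun 'I_n -> T}) : fcons a c ord0 = a.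
Proof. by rewrite ffunE unlift_none. Qed.

Lemma fconsS n T a (c : {ffun 'I_n -> T}) i : fcons a c (lift ord0 i) = c i.
Proof. by rewrite ffunE liftK. Qed.

Lemma sum_fcons n (T : finType) (F : {ffun 'I_n.+1 -> T} -> R) :
  \sum_c F c = \sum_a \sum_c F (fcons a c).
Proof.
rewrite pair_bigA /=.
rewrite (reindex (fun ac : T * {ffun 'I_n -> T} => fcons ac.1 ac.2)) //=.
exists (fun c : {ffun 'I_n.+1 -> T} => (c ord0, [ffun i => c (lift ord0 i)])).
  move=> [a c] _ /=; rewrite fcons0; congr pair; apply/ffunP => i.
  by rewrite ffunE fconsS.
move=> c _ /=; apply/ffunP => i; rewrite ffunE.
by case: unliftP => [j ->|->]; rewrite ?ffunE.
Qed.

Lemma prod_meanS n (T : finType) (w : 'I_n.+1 -> T -> R) F :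
  prod_mean w F = \sum_a w ord0 a *
     prod_mean (fun i => w (lift ord0 i)) (fun c => F (fcons a c)).
Proof.
rewrite /prod_mean sum_fcons; apply: eq_bigr => a _.
rewrite mulr_sumr; apply: eq_bigr => c _.
rewrite big_ord_recl fcons0 -!mulrA; congr (_ * (_ * _)).
by apply: eq_bigr => i _; rewrite fconsS.
Qed.

Lemma ler_prod_mean n (T : finType) (w : 'I_n -> T -> R) F G :
  (forall i a, 0 <= w i a) -> (forall c, F c <= G c) -> prod_mean w F <= prod_mean w G.
Proof.
move=> w0 FG; apply: ler_sum => c _; apply: ler_wpM2l => //.
exact: prodr_ge0.
Qed.

Lemma prod_mean_sum n (T : finType) (w : 'I_n -> T -> R) (I : Type) (s : seq I)
    (P : pred I) (F : I -> {ffun 'I_n -> T} -> R) :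
  prod_mean w (fun c => \sum_(i <- s | P i) F i c) = \sum_(i <- s | P i) prod_mean w (F i).
Proof.
rewrite /prod_mean exchange_big /=; apply: eq_bigr => c _.
by rewrite mulr_sumr.
Qed.

Lemma prod_meanZ n (T : finType) (w : 'I_n -> T -> R) k F :
  prod_mean w (fun c => k * F c) = k * prod_mean w F.
Proof. by rewrite /prod_mean mulr_sumr; apply: eq_bigr => c _; rewrite mulrCA. Qed.

Lemma prod_meanD n (T : finType) (w : 'I_n -> T -> R) F G :
  prod_mean w (fun c => F c + G c) = prod_mean w F + prod_mean w G.
Proof. by rewrite /prod_mean -big_split; apply: eq_bigr => c _ /=; rewrite mulrDr. Qed.

Lemma prod_mean_cst n (T : finType) (w : 'I_n -> T -> R) k :
  (forall i, \sum_a w i a = 1) -> prod_mean w (fun=> k) = k.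
Proof.
move=> w1; rewrite /prod_mean -mulr_suml -(bigA_distr_bigA w).
by rewrite big1 ?mul1r.
Qed.

End ProductExpectation.

(** * Exponential moment of a quadratic form in independent vectors *)

Section ExpMoment.
Variables (R : realType) (p q : nat) (T : finType).
Local Notation V := 'M[R]_(p, q).
Implicit Types (A : V -> V) (x y z : V).

Definition centered_sum n (w : 'I_n -> T -> R) (v : 'I_n -> T -> V)
    (c : {ffun 'I_n -> T}) : V :=
  \sum_i (v i (c i) - \sum_a w i a *: v i a).

Lemma centered_sumS n (w : 'I_n.+1 -> T -> R) v a c :
  centered_sum w v (fcons a c) = (v ord0 a - \sum_b w ord0 b *: v ord0 b) +
    centered_sum (fun i => w (lift ord0 i)) (fun i => v (lift ord0 i)) c.
Proof.
rewrite /centered_sum big_ord_recl fcons0; congr (_ + _).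
by apply: eq_bigr => i _; rewrite fconsS.
Qed.

(** Operators are functions with properties rather than matrices, so that no basis
    of the space of matrices has to be chosen. *)
Record sym_op A : Prop := {
  op_lin : forall k x y, A (k *: x + y) = k *: A x + A y ;
  op_sym : forall x y, mxdot (A x) y = mxdot x (A y) }.

(** What remains of exp<A S, S> once a vector e v is added to S and its random sign
    e averaged out: the cross term exp (2 e <Av, S>) has mean at most
    exp (8 <Av, S>^2), which is the quadratic form added here. *)
Definition rank_one_update A v x := A x + (8 * mxdot (A v) x) *: A v.

Lemma sym_op_update A v : sym_op A -> sym_op (rank_one_update A v).
Proof.
move=> [Al As]; split => [k x y|x y]; rewrite /rank_one_update.
  rewrite Al mxdotDr mxdotZr mulrDr !scalerDr scalerDl scalerA mulrCA.
  by rewrite -!addrA; congr (_ + _); rewrite addrCA.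
rewrite !mxdotE -As (mxdotC x (A v)); congr (_ + _); ring.
Qed.

Lemma op_add A x y : sym_op A -> A (x + y) = A x + A y.
Proof. by move=> [Al _]; rewrite -[x]scale1r Al !scale1r. Qed.

Lemma op_opp A x : sym_op A -> A (- x) = - A x.
Proof.
move=> hA; have h0 : A 0 = 0.
  by apply: (addrI (A 0)); rewrite -op_add // !addr0.
have [Al _] := hA; by rewrite -scaleN1r -[_ *: x]addr0 Al h0 addr0 scaleN1r.
Qed.

(** For invertible A this says that the inverse of A dominates b + 8 Q. In this
    form averaging out v, which replaces A by rank_one_update A v, costs at most
    8 <v, .>^2 (Sherman-Morrison), and no inverse is ever taken. *)
Definition op_bound A b (Q : V -> R) :=
  forall x, b * mxdot (A x) (A x) + 8 * Q (A x) <= mxdot x (A x).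

Lemma op_bound_ge0 A b Q x : 0 < b -> (forall y, 0 <= Q y) -> op_bound A b Q ->
  0 <= mxdot x (A x).
Proof.
move=> b0 Q0 /(_ x); apply: le_trans.
by rewrite addr_ge0 ?mulr_ge0 ?mxdot_ge0 ?Q0 // ltW.
Qed.

Lemma op_bound_le A b Q x : 0 < b -> (forall y, 0 <= Q y) -> op_bound A b Q ->
  mxdot x (A x) <= mxdot x x / b.
Proof.
move=> b0 Q0 /(_ x) hx.
have h := mxdot_ge0 (x - b *: A x).
rewrite !mxdotE (mxdotC (A x) x) in h.
rewrite ler_pdivlMr //.
have hQ := Q0 (A x).
have h2 : b * (b * mxdot (A x) (A x)) <= b * mxdot x (A x).
  by rewrite ler_pM2l //; lra.
lra.
Qed.

(** The budget Q pays for the vector v: its share <v, .>^2 is spent, and the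
    remainder Q' still bounds the updated operator. Writing the updated operator
    at x as A z with z = x + 8 <Av, x> v, the claim is the old bound at z. *)
Lemma op_bound_update A b Q Q' v : sym_op A -> 0 < b ->
  (forall y, 0 <= Q' y) ->
  (forall y, mxdot v y ^+ 2 + Q' y <= Q y) ->
  op_bound A b Q -> op_bound (rank_one_update A v) b Q'.
Proof.
move=> hA b0 Q0 hQ hB x.
have [Al As] := hA.
have Q0' y : 0 <= Q y.
  by apply: le_trans (hQ y); rewrite addr_ge0 ?sqr_ge0.
set c := mxdot (A v) x.
have e : rank_one_update A v x = A ((8 * c) *: v + x).
  by rewrite /rank_one_update Al addrC.
rewrite e.
have ha := op_bound_ge0 v b0 Q0' hB.
have := hB ((8 * c) *: v + x).
have := hQ (A ((8 * c) *: v + x)).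
set B := mxdot (A _) (A _); set q1 := Q _; set q2 := Q' _.
rewrite Al !mxdotE.
have -> : mxdot v (A x) = c by rewrite -As.
rewrite (mxdotC x (A v)) -/c.
set a := mxdot v (A v) in ha *; set X := mxdot x (A x).
move=> h1 h2.
have h3 : 0 <= c ^+ 2 * a by rewrite mulr_ge0 ?sqr_ge0.
have h4 : 0 <= (c * a) ^+ 2 by rewrite sqr_ge0.
nra.
Qed.

(** One coordinate is averaged out. Replacing its mean by an independent copy can
    only increase the exponential (Jensen, the form being convex); the difference
    v a - v b is then symmetric, so that x sees it as a random sign. *)
Lemma centered_sum_step A (w : T -> R) (v : T -> V) x : sym_op A ->
  (forall y, 0 <= mxdot y (A y)) ->
  (forall a, 0 <= w a) -> \sum_a w a = 1 ->
  \sum_a w a * expR (mxdot (v a - \sum_b w b *: v b + x)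
                        (A (v a - \sum_b w b *: v b + x))) <=
  \sum_a \sum_b w a * w b *
     (expR (mxdot (v a - v b) (A (v a - v b))) *
      expR (mxdot x (rank_one_update A (v a - v b) x))).
Proof.
move=> hA A0 w0 w1; have [Al As] := hA.
pose E a b := expR (mxdot (v a - v b + x) (A (v a - v b + x))).
have jensen a : expR (mxdot (v a - \sum_b w b *: v b + x)
                        (A (v a - \sum_b w b *: v b + x))) <= \sum_b w b * E a b.
  apply: le_trans (expR_jensen _ w0 w1).
  rewrite ler_expR.
  set m := \sum_b w b *: v b.
  have id1 b : mxdot (v a - v b + x) (A (v a - v b + x)) =
      mxdot (v a - m + x) (A (v a - m + x)) + mxdot (m - v b) (A (m - v b)) +
      2 * mxdot (m - v b) (A (v a - m + x)).
    have -> : v a - v b + x = (m - v b) + (v a - m + x).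
      by apply/matrixP => i j; rewrite !mxE; ring.
    move: (m - v b) (v a - m + x) => u t.
    by rewrite (op_add _ _ hA) !mxdotDl !mxdotDr -(As t u) (mxdotC (A t)); ring.
  under [leRHS]eq_bigr do rewrite id1 !mulrDr.
  rewrite !big_split /= -mulr_suml w1 mul1r -addrA lerDl.
  apply: addr_ge0; first by apply: sumr_ge0 => b _; rewrite mulr_ge0.
  under eq_bigr do rewrite mulrCA -mxdotZl.
  rewrite -mulr_sumr -mxdot_suml.
  under eq_bigr do rewrite scalerBr.
  by rewrite big_split /= -scaler_suml w1 scale1r sumrN subrr mxdot0l mulr0.
have sym a b : E a b + E b a <= 2 * (expR (mxdot (v a - v b) (A (v a - v b))) *
      expR (mxdot x (rank_one_update A (v a - v b) x))).
  rewrite /E -(opprB (v a) (v b)); move: (v a - v b) => d.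
  have e1 : mxdot (d + x) (A (d + x)) =
      (mxdot d (A d) + mxdot x (A x)) + 2 * mxdot (A d) x.
    by rewrite (op_add _ _ hA) !mxdotE -(As d x) (mxdotC x (A d)); ring.
  have e2 : mxdot (- d + x) (A (- d + x)) =
      (mxdot d (A d) + mxdot x (A x)) + - (2 * mxdot (A d) x).
    rewrite (op_add _ _ hA) (op_opp _ hA) !mxdotE -(As d x) (mxdotC x (A d)); ring.
  rewrite e1 e2 !(expRD (_ + _)) -mulrDr.
  have -> : expR (mxdot d (A d)) * expR (mxdot x (rank_one_update A d x)) =
     expR (mxdot d (A d) + mxdot x (A x)) * expR (2 * (2 * mxdot (A d) x) ^+ 2).
    rewrite -!expRD; congr expR; rewrite /rank_one_update !mxdotE (mxdotC x (A d)).
    ring.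
  by rewrite mulrCA ler_pM2l ?expR_gt0 // cosh_le_exp_sqr.
apply: (@le_trans _ _ (\sum_a \sum_b w a * w b * E a b)).
  apply: ler_sum => a _; under [leRHS]eq_bigr do rewrite -mulrA.
  by rewrite -mulr_sumr ler_wpM2l.
rewrite -(ler_pM2l (_ : 0 < 2 :> R)) //.
have -> : 2 * (\sum_a \sum_b w a * w b * E a b) =
    \sum_a \sum_b w a * w b * (E a b + E b a).
  under [RHS]eq_bigr do (under eq_bigr do rewrite mulrDr; rewrite big_split /=).
  rewrite big_split /= [X in _ = _ + X]exchange_big /= mulr2n mulrDl !mul1r.
  congr (_ + _); apply: eq_bigr => a _; apply: eq_bigr => b _.
  by rewrite (mulrC (w b)).
rewrite mulr_sumr; apply: ler_sum => a _.
rewrite mulr_sumr; apply: ler_sum => b _.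
by rewrite mulrCA ler_wpM2l ?mulr_ge0.
Qed.

(** A Hanson-Wright bound that depends on the range of the independent vectors only
    through Q and dd, hence not on their dimension. Averaging out the coordinates
    in turn, each costs exp <Av, v> <= exp (dd i / b), because the operators met
    on the way all satisfy op_bound with the same b. *)
Lemma quadratic_exp_moment n : forall (w : 'I_n -> T -> R) (v : 'I_n -> T -> V)
    (Q : 'I_n -> V -> R) (dd : 'I_n -> R) (b : R) (A : V -> V),
  (forall i a, 0 <= w i a) -> (forall i, \sum_a w i a = 1) ->
  sym_op A -> 0 < b ->
  (forall i y, 0 <= Q i y) ->
  (forall i a a' y, mxdot (v i a - v i a') y ^+ 2 <= Q i y) ->
  (forall i a a', mxdot (v i a - v i a') (v i a - v i a') <= dd i) ->
  op_bound A b (fun y => \sum_i Q i y) ->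
  prod_mean w (fun c => expR (mxdot (centered_sum w v c) (A (centered_sum w v c)))) <=
    expR ((\sum_i dd i) / b).
Proof.
elim: n => [|n IH] w v Q dd b A w0 w1 hA b0 Q0 hQ hd hB.
  rewrite (_ : (fun c => _) = fun=> 1); last first.
    by apply/funext => c; rewrite /centered_sum big_ord0 mxdot0l expR0.
  by rewrite prod_mean_cst // big_ord0 mul0r expR0.
have Qs0 y : 0 <= \sum_i Q i y by apply: sumr_ge0.
rewrite prod_meanS /=.
set w' := fun i => w (lift ord0 i); set v' := fun i => v (lift ord0 i).
under eq_bigr => a _.
  rewrite (_ : (fun c => _) = (fun c => expR
    (mxdot (v ord0 a - \sum_b0 w ord0 b0 *: v ord0 b0 + centered_sum w' v' c)
       (A (v ord0 a - \sum_b0 w ord0 b0 *: v ord0 b0 + centered_sum w' v' c))))); last first.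
    by apply/funext => c; rewrite centered_sumS.
  rewrite -prod_meanZ; over.
rewrite -prod_mean_sum.
have w0' i a : 0 <= w' i a by exact: w0.
apply: (le_trans (ler_prod_mean w0' (fun c => centered_sum_step (v ord0) (centered_sum w' v' c) hA
   (fun y => op_bound_ge0 y b0 Qs0 hB) (w0 ord0) (w1 ord0)))).
rewrite prod_mean_sum /=.
under eq_bigr => a _.
  rewrite prod_mean_sum /=.
  under eq_bigr do rewrite prod_meanZ prod_meanZ.
  over.
have key a a' : expR (mxdot (v ord0 a - v ord0 a') (A (v ord0 a - v ord0 a'))) *
   prod_mean w' (fun c => expR (mxdot (centered_sum w' v' c)
       (rank_one_update A (v ord0 a - v ord0 a') (centered_sum w' v' c)))) <=
   expR ((\sum_i dd i) / b).
  rewrite big_ord_recl mulrDl expRD.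
  apply: ler_pM; rewrite ?expR_ge0 //.
  - by apply: sumr_ge0 => c _; rewrite mulr_ge0 ?expR_ge0 // prodr_ge0.
  - rewrite ler_expR (le_trans (op_bound_le _ b0 Qs0 hB)) //.
    by rewrite ler_wpM2r ?invr_ge0 ?hd // ltW.
  - apply: (IH w' v' (fun i => Q (lift ord0 i)) (fun i => dd (lift ord0 i))) => //.
    + by move=> i; exact: w1.
    + exact: sym_op_update.
    + by move=> i a1 a2 y; exact: hQ.
    + by move=> i a1 a2; exact: hd.
    + apply: op_bound_update hB => //.
        by move=> y; apply: sumr_ge0 => i _; exact: Q0.
      by move=> y; rewrite [leRHS]big_ord_recl lerD2r.
apply: (@le_trans _ _ (\sum_a \sum_a' w ord0 a * w ord0 a' * expR ((\sum_i dd i) / b))).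
  apply: ler_sum => a _; apply: ler_sum => a' _.
  by rewrite ler_wpM2l ?mulr_ge0.
under [leLHS]eq_bigr do rewrite -mulr_suml -mulr_sumr w1 mulr1.
by rewrite -mulr_suml w1 mul1r.
Qed.

End ExpMoment.

(** * The Haar basis *)

Section DyadicSums.
Variable R : realType.

Lemma sum_div (h M : nat) (F : nat -> R) : (0 < h)%N ->
  \sum_(0 <= i < M * h) F (i %/ h)%N = h%:R * \sum_(0 <= u < M) F u.
Proof.
move=> h0; rewrite big_nat_mul mulr_sumr; apply: eq_bigr => u _.
rewrite (eq_big_nat _ _ (F2 := fun=> F u)); last first.
  move=> i /andP[h1 h2]; congr F; apply/eqP.
  by rewrite eqn_leq -ltnS ltn_divLR // h2 leq_divRL.
by rewrite big_const_nat iter_addr_0 mulSn addnK mulr_natl.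
Qed.

(** Consecutive terms 2v, 2v+1 cancel. This is the vanishing mean of a wavelet. *)
Lemma sum_alternating (M : nat) (g : nat -> R) :
  \sum_(0 <= u < M * 2) (-1) ^+ u * g u./2 = 0.
Proof.
rewrite big_nat_mul big1 // => u _.
rewrite big_ltn; last by lia.
rewrite big_ltn; last by lia.
rewrite big_geq; last by lia.
have -> : (u * 2).+1./2 = u by lia.
have -> : (u * 2)./2 = u by lia.
by rewrite /= addr0 exprS mulN1r mulNr subrr.
Qed.

(** The wavelet with index k as a function of the number a of a half support:
    1 for a = 2k, -1 for a = 2k+1, and 0 otherwise. *)
Definition haar_sign (a k : nat) : R := (a./2 == k)%:R * (-1) ^+ a.

(** The half-open dyadic intervals ]0, 1/2] and ]1/2, 1] turn into Euclidean division
    because the components are numbered from 0 on the right-hand side. *)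
Lemma haar_motherE (h i k : nat) : (0 < h)%N ->
  haar_mother (i.+1%:R / (h.*2)%:R - k%:R : R) = haar_sign (i %/ h) k.
Proof.
move=> h0; have hR : 0 < (h.*2)%:R :> R by rewrite ltr0n double_gt0.
set x := _ - _.
have c1 : (0 < x) = (k.*2 <= i %/ h)%N.
  rewrite /x subr_gt0 ltr_pdivlMr // -natrM ltr_nat ltnS leq_divRL //.
  by congr (_ <= _)%N; lia.
have c2 : (x <= 1 / 2) = (i %/ h < k.*2.+1)%N.
  rewrite /x lerBlDr ler_pdivrMr // ltn_divLR //.
  have -> : (1 / 2 + k%:R) * (h.*2)%:R = (k.*2.+1 * h)%:R :> R.
    rewrite -!mul2n -addn1 !(natrM, natrD); by field.
  by rewrite ler_nat.
have c3 : (1 / 2 < x) = ~~ (i %/ h < k.*2.+1)%N by rewrite -c2 ltNge.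
have c4 : (x <= 1) = (i %/ h < k.*2.+2)%N.
  rewrite /x lerBlDr ler_pdivrMr // ltn_divLR //.
  have -> : (1 + k%:R) * (h.*2)%:R = (k.*2.+2 * h)%:R :> R.
    rewrite -!mul2n -addn2 !(natrM, natrD); ring.
  by rewrite ler_nat.
rewrite /haar_mother c1 c2 c3 c4 /haar_sign; move: (i %/ h)%N => a.
have -> : (k.*2 <= a)%N && (a < k.*2.+1)%N = (a == k.*2) by lia.
have -> : ~~ (a < k.*2.+1)%N && (a < k.*2.+2)%N = (a == k.*2.+1) by lia.
case: eqP => [->|n1].
  by rewrite doubleK eqxx mul1r -signr_odd odd_double.
case: eqP => [->|n2].
  by rewrite /= uphalf_double eqxx mul1r -signr_odd /= odd_double.
have -> : (a./2 == k) = false by lia.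
by rewrite mul0r.
Qed.

Lemma sum_haar_sign M k (g : nat -> R) :
  \sum_(0 <= u < M * 2) haar_sign u k * g u./2 = 0.
Proof.
rewrite -[RHS](sum_alternating M (fun v => (v == k)%:R * g v)).
by apply: eq_bigr => u _; rewrite /haar_sign; ring.
Qed.

Lemma haar_sign_sqr a k : haar_sign a k * haar_sign a k = (a./2 == k)%:R.
Proof.
by rewrite mulrACA -natrM mulnb andbb -expr2 sqrr_sign mulr1.
Qed.

End DyadicSums.

Section HaarBasis.
Variables (R : realType) (N : nat).
Local Notation n := (2 ^ N)%N.
Implicit Types l : Lambda N.

Lemma mxdot_rowE (x y : 'rV[R]_n) : mxdot x y = \sum_(i < n) x 0 i * y 0 i.
Proof. by rewrite /mxdot big_ord1. Qed.

Definition half_supp (j : nat) : nat := (2 ^ (N - j.+1))%N.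

Lemma half_supp_gt0 j : (0 < half_supp j)%N.
Proof. by rewrite expn_gt0. Qed.

Lemma half_suppE (j : nat) : (j < N)%N -> n = (2 ^ j * 2 * half_supp j)%N.
Proof. by move=> jN; rewrite -expnSr -expnD subnKC. Qed.

Definition haar_amp (j : nat) : R := 2 `^ (j%:R / 2) / Num.sqrt n%:R.

Lemma haar_amp_sqr j : haar_amp j ^+ 2 = (2 ^ j)%:R / n%:R.
Proof.
rewrite /haar_amp expr_div_n sqr_sqrtr ?ler0n //; congr (_ / _); rewrite natrX.
by rewrite -powR_mulrn ?powR_ge0 // -powRrM mulfVK ?pnatr_eq0 // powR_mulrn.
Qed.

Lemma haar_SomeE (j : 'I_N) (k : 'I_(2 ^ j)) (i : 'I_n) :
  haar R (Some (Tagged (fun j : 'I_N => 'I_(2 ^ j)) k)) 0 i =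
  haar_amp j * haar_sign R (i %/ half_supp j) k.
Proof.
rewrite mxE /= -/(haar_amp j); congr (_ * _).
rewrite -haar_motherE ?half_supp_gt0 //; congr (haar_mother (_ - _)).
have -> : n%:R = (2 ^ j)%:R * 2 * (half_supp j)%:R :> R.
  by rewrite -!natrM -half_suppE.
rewrite -natrX -mul2n natrM.
by field; rewrite !pnatr_eq0 -!lt0n half_supp_gt0 expn_gt0.
Qed.

Lemma sum_level_shift (j : nat) (F : nat -> R) : (j < N)%N ->
  \sum_(i < n) F (i %/ half_supp j)%N =
  (half_supp j)%:R * \sum_(0 <= u < 2 ^ j * 2) F u.
Proof.
move=> jN; rewrite -(big_mkord xpredT (fun i => F (i %/ half_supp j)%N)).
by rewrite {1}(half_suppE jN) sum_div ?half_supp_gt0.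
Qed.

(** The coarser wavelet is constant on the support of the finer one, whose
    components sum to zero. *)
Lemma haar_orth_lt (j j' : 'I_N) (k : 'I_(2 ^ j)) (k' : 'I_(2 ^ j')) :
  (j < j')%N ->
  mxdot (haar R (Some (Tagged (fun j : 'I_N => 'I_(2 ^ j)) k)))
        (haar R (Some (Tagged (fun j : 'I_N => 'I_(2 ^ j)) k'))) = 0.
Proof.
move=> jj; rewrite mxdot_rowE.
pose e := (2 ^ (j' - j.+1))%N.
pose F u := haar_amp j * haar_amp j' *
    (haar_sign R u k' * haar_sign R (u./2 %/ e) k).
transitivity (\sum_(i < n) F (i %/ half_supp j')%N).
  apply: eq_bigr => i _; rewrite !haar_SomeE /F.
  have -> : (i %/ half_supp j)%N = ((i %/ half_supp j')./2 %/ e)%N.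
    have -> : half_supp j = (half_supp j' * (2 * e))%N; last first.
      by rewrite -divn2 -!divnMA mulnA.
    rewrite /half_supp /e -expnS -expnD; congr (_ ^ _)%N.
    by have := ltn_ord j'; lia.
  by ring.
rewrite sum_level_shift // /F -mulr_sumr.
by rewrite (sum_haar_sign _ _ (fun v => haar_sign R (v %/ e) k)) !mulr0.
Qed.

Lemma haar_orthonormal l l' : mxdot (haar R l) (haar R l') = (l == l')%:R.
Proof.
have noneS (u : {j : 'I_N & 'I_(2 ^ j)}) : mxdot (haar R None) (haar R (Some u)) = 0.
  case: u => j k; rewrite mxdot_rowE.
  pose F u := (1 / Num.sqrt n%:R) * haar_amp j * (haar_sign R u k * 1).
  transitivity (\sum_(i < n) F (i %/ half_supp j)%N).
    apply: eq_bigr => i _; rewrite haar_SomeE mxE /F mulr1; ring.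
  rewrite sum_level_shift // /F -mulr_sumr.
  by rewrite (sum_haar_sign _ _ (fun=> 1)) !mulr0.
case: l l' => [u|] [u'|]; last 2 first.
- by rewrite noneS.
- rewrite mxdot_rowE eqxx.
  under eq_bigr do rewrite mxE /= -expr2 expr_div_n expr1n sqr_sqrtr ?ler0n //.
  rewrite sumr_const card_ord -[LHS]mulr_natr mul1r mulVf //.
- case: u u' => [j k] [j' k'].
  have [jj|jj|jj] := ltngtP j j'.
  + rewrite haar_orth_lt //; case: eqP => // -[e _].
    by rewrite e ltnn in jj.
  + rewrite mxdotC haar_orth_lt //; case: eqP => // -[e _].
    by rewrite e ltnn in jj.
  + have ej : j = j' by apply: val_inj.
    case: j' / ej jj k' => _ k'.
    rewrite mxdot_rowE.
    pose F u := haar_amp j ^+ 2 * (haar_sign R u k * haar_sign R u k').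
    transitivity (\sum_(i < n) F (i %/ half_supp j)%N).
      by apply: eq_bigr => i _; rewrite !haar_SomeE /F; ring.
    rewrite sum_level_shift // /F -mulr_sumr.
    have [<-|nk] := eqVneq k k'.
      under eq_bigr do rewrite haar_sign_sqr.
      have -> : \sum_(0 <= u < 2 ^ j * 2) (u./2 == k)%:R = 2 :> R.
        under eq_bigr do rewrite -divn2.
        rewrite (sum_div _ (fun v => (v == k)%:R)) // big_mkord.
        rewrite (bigD1 k) //= eqxx big1 ?addr0 ?mulr1 // => v vk.
        by rewrite (inj_eq val_inj) (negbTE vk).
      rewrite haar_amp_sqr eqxx (half_suppE (ltn_ord j)) !natrM.
rewrite [RHS]/=; by field; rewrite !pnatr_eq0 -!lt0n half_supp_gt0 expn_gt0.
    rewrite big1 ?mulr0; last first.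
      move=> u _; rewrite /haar_sign; case: eqP => [e1|]; last by rewrite !mul0r.
      case: eqP => [e2|]; last by rewrite mul0r mulr0.
      by case/eqP: nk; apply: val_inj; rewrite /= -e1 -e2.
    case: eqP => // -[] /eqP; rewrite eq_Tagged /= => /eqP e.
    by rewrite e eqxx in nk.
by rewrite mxdotC noneS.
Qed.

Lemma card_Lambda : #|Lambda N| = n.
Proof.
rewrite card_option card_tagged sumnE big_map big_enum /=.
under eq_bigr do rewrite card_ord.
have -> : (\sum_(i < N) 2 ^ i = (2 ^ N).-1)%N.
  elim: N => [|M IH]; first by rewrite big_ord0.
  by rewrite big_ord_recr /= IH expnS; have := expn_gt0 2 M; lia.
by rewrite prednK ?expn_gt0.
Qed.

(** The square matrix of the Haar vectors has orthonormal rows, hence orthonormal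
    columns. *)
Lemma haar_complete (i i' : 'I_n) :
  \sum_l haar R l 0 i * haar R l 0 i' = (i == i')%:R.
Proof.
pose f (a : 'I_n) : Lambda N := enum_val (cast_ord (esym card_Lambda) a).
have fbij : bijective f.
  exists (fun l => cast_ord card_Lambda (enum_rank l)) => x; rewrite /f.
    by rewrite enum_valK cast_ordKV.
  by rewrite cast_ordK enum_rankK.
pose H : 'M[R]_n := \matrix_(a, b) haar R (f a) 0 b.
have HHT : H *m H^T = 1%:M.
  apply/matrixP => a b; rewrite !mxE.
  under eq_bigr do rewrite [H^T _ _]mxE [H _ _]mxE [H _ _]mxE.
  rewrite -mxdot_rowE haar_orthonormal.
  by rewrite (inj_eq (bij_inj fbij)).
have := mulmx1C HHT => /matrixP /(_ i i'); rewrite !mxE => <-.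
rewrite (reindex f) /=; last exact: onW_bij.
by apply: eq_bigr => a _; rewrite [H^T _ _]mxE [H _ _]mxE [H _ _]mxE.
Qed.

End HaarBasis.

Section Coefficients.
Variables (R : realType) (r N : nat).
Local Notation n := (2 ^ N)%N.
Implicit Types (l : Lambda N) (t x y : 'M[R]_(r, n)) (m : {set Lambda N}).

Lemma haar_coefE t l j : haar_coef t l 0 j = \sum_(i < n) t j i * haar R l 0 i.
Proof. by rewrite mxE mxdot_rowE; apply: eq_bigr => i _; rewrite !mxE. Qed.

Lemma haar_coefD t t' l : haar_coef (t + t') l = haar_coef t l + haar_coef t' l.
Proof.
apply/rowP => j; rewrite [RHS]mxE !haar_coefE -big_split; apply: eq_bigr => i _.
by rewrite mxE mulrDl.
Qed.

Lemma haar_coefZ a t l : haar_coef (a *: t) l = a *: haar_coef t l.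
Proof.
apply/rowP => j; rewrite [RHS]mxE !haar_coefE mulr_sumr; apply: eq_bigr => i _.
by rewrite mxE mulrA.
Qed.

Lemma haar_coefN t l : haar_coef (- t) l = - haar_coef t l.
Proof. by rewrite -scaleN1r haar_coefZ scaleN1r. Qed.

Lemma parseval t t' :
  mxdot t t' = \sum_l mxdot (haar_coef t l) (haar_coef t' l).
Proof.
rewrite /mxdot; under [RHS]eq_bigr do rewrite big_ord1.
rewrite [RHS]exchange_big /=; apply: eq_bigr => j _.
transitivity (\sum_(i < n) \sum_(i' < n) t j i * t' j i' *
    \sum_l haar R l 0 i * haar R l 0 i').
  apply: eq_bigr => i _; rewrite (bigD1 i) //= haar_complete eqxx mulr1.
  rewrite big1 ?addr0 // => i' ii'.
  by rewrite haar_complete eq_sym (negbTE ii') mulr0.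
transitivity (\sum_(i < n) \sum_l \sum_(i' < n)
    t j i * t' j i' * (haar R l 0 i * haar R l 0 i')).
  apply: eq_bigr => i _; rewrite exchange_big; apply: eq_bigr => i' _.
  by rewrite mulr_sumr.
rewrite exchange_big /=; apply: eq_bigr => l _.
rewrite !haar_coefE mulr_suml; apply: eq_bigr => i _.
by rewrite mulr_sumr; apply: eq_bigr => i' _; ring.
Qed.

Definition haar_proj m t : 'M[R]_(r, n) :=
  \matrix_(j, i) \sum_(l in m) haar_coef t l 0 j * haar R l 0 i.

Lemma haar_coef_proj m t l :
  haar_coef (haar_proj m t) l = if l \in m then haar_coef t l else 0.
Proof.
apply/rowP => j; rewrite haar_coefE.
under eq_bigr do rewrite mxE mulr_suml.
rewrite exchange_big /=.
transitivity (\sum_(l' in m) haar_coef t l' 0 j * (l' == l)%:R).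
  apply: eq_bigr => l' _; rewrite -haar_orthonormal mxdot_rowE mulr_sumr.
  by apply: eq_bigr => i _; rewrite mulrA.
case: ifPn => lm.
  rewrite (bigD1 l) //= eqxx mulr1 big1 ?addr0 // => l' /andP[_ /negbTE ->].
  by rewrite mulr0.
rewrite mxE big1 // => l' l'm; case: eqP => [e|]; last by rewrite mulr0.
by rewrite -e l'm in lm.
Qed.

Lemma haar_span_coef m t : lines_in (haar_span R m) t ->
  forall l, l \notin m -> haar_coef t l = 0.
Proof.
move=> tm l lm; apply/rowP => j; rewrite mxE [RHS]mxE.
have := tm j; rewrite /haar_span => /(@coord_span _ _ _ (in_tuple _)) ->.
rewrite mxdot_suml big1 // => i _; rewrite mxdotZl.
have si : (i < size (enum m))%N by rewrite -(size_map (haar R (N:=N))) ltn_ord.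
rewrite (nth_map None) // haar_orthonormal.
case: eqP => [e|]; last by rewrite mulr0.
have : nth None (enum m) i \in m by rewrite -mem_enum mem_nth.
by rewrite e (negbTE lm).
Qed.

Lemma haar_proj_in m t : lines_in (haar_span R m) (haar_proj m t).
Proof.
move=> j.
have -> : row j (haar_proj m t) = \sum_(l in m) haar_coef t l 0 j *: haar R l.
  apply/rowP => i; rewrite mxE mxE summxE; apply: eq_bigr => l _.
  by rewrite [RHS]mxE.
apply: memv_suml => l lm; apply: memvZ; apply: memv_span.
by apply/mapP; exists l; rewrite ?mem_enum.
Qed.

Lemma haar_proj_orth m t u : lines_in (haar_span R m) u ->
  mxdot (t - haar_proj m t) u = 0.
Proof.
move=> um; rewrite parseval big1 // => l _.
rewrite haar_coefD haar_coefN haar_coef_proj.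
case: ifPn => lm; first by rewrite subrr mxdot0l.
by rewrite (haar_span_coef um lm) mxdotC mxdot0l.
Qed.

Lemma haar_proj_is_orth_proj m t : is_orth_proj (haar_span R m) t (haar_proj m t).
Proof. by split; [exact: haar_proj_in|exact: haar_proj_orth]. Qed.

End Coefficients.

Lemma dim_haar_span (R : realType) N (m : {set Lambda N}) :
  \dim (haar_span R m) = #|m|.
Proof.
have /eqP -> : free [seq haar R l | l <- enum m]; last by rewrite size_map cardE.
have sz := size_map (haar R (N:=N)) (enum m).
rewrite -[X in free X]/(tval (in_tuple _)); apply/freeP => k hk i.
have si : (i < size (enum m))%N by rewrite -(size_map (haar R (N:=N))) ltn_ord.
have : mxdot (\sum_(i < size [seq haar R l | l <- enum m])
    k i *: (in_tuple [seq haar R l | l <- enum m])`_i)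
   (haar R (nth None (enum m) i)) = 0 by rewrite hk mxdot0l.
rewrite mxdot_suml (bigD1 i) //= mxdotZl (nth_map None) // haar_orthonormal.
rewrite eqxx mulr1 big1 ?addr0 // => i' ii'.
have si' : (i' < size (enum m))%N by rewrite -(size_map (haar R (N:=N))) ltn_ord.
rewrite mxdotZl (nth_map None) // haar_orthonormal.
rewrite nth_uniq ?enum_uniq // (inj_eq val_inj) (negbTE ii') mulr0 //.
Qed.

(** * Energy of the noise in a model *)

Section Noise.
Variables (R : realType) (r N : nat).
Local Notation n := (2 ^ N)%N.
Local Notation V := 'M[R]_(r, n).
Implicit Types (m : {set Lambda N}) (x y s : V).

Lemma haar_proj_linear m : linear (@haar_proj R r N m).
Proof.
move=> k x y; apply/matrixP => j i; rewrite !mxE mulr_sumr -big_split /=.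
by apply: eq_bigr => l _; rewrite haar_coefD haar_coefZ 2!mxE; ring.
Qed.

HB.instance Definition _ m := GRing.isLinear.Build R V V *:%R
  (@haar_proj R r N m) (haar_proj_linear m).

Definition energy m x : R := \sum_(l in m) mxdot (haar_coef x l) (haar_coef x l).

Lemma mxdot_proj m x y : mxdot (haar_proj m x) y =
  \sum_(l in m) mxdot (haar_coef x l) (haar_coef y l).
Proof.
rewrite parseval [RHS]big_mkcond; apply: eq_bigr => l _ /=.
by rewrite haar_coef_proj; case: ifP => // _; rewrite mxdot0l.
Qed.

Lemma mxdot_projC m x y : mxdot (haar_proj m x) y = mxdot x (haar_proj m y).
Proof.
rewrite [RHS]mxdotC !mxdot_proj; apply: eq_bigr => l _; exact: mxdotC.
Qed.

Lemma haar_proj_idem m x : haar_proj m (haar_proj m x) = haar_proj m x.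
Proof.
apply/matrixP => j i; rewrite !mxE; apply: eq_bigr => l lm.
by rewrite haar_coef_proj lm.
Qed.

Lemma energyE m x : mxdot (haar_proj m x) (haar_proj m x) = energy m x.
Proof. by rewrite -mxdot_projC haar_proj_idem mxdot_proj. Qed.

Lemma energy_le m x : energy m x <= mxdot x x.
Proof.
rewrite parseval /energy big_mkcond; apply: ler_sum => l _ /=.
by case: ifP => // _; exact: mxdot_ge0.
Qed.

Definition obs (c : {ffun 'I_n -> 'I_r}) : V := \matrix_(j, i) (c i == j)%:R.

Lemma mxdot_delta a i y : mxdot (delta_mx a i) y = y a i.
Proof.
rewrite /mxdot (bigD1 a) //= (bigD1 i) //= mxE !eqxx mul1r.
rewrite big1 => [|i' ii']; last by rewrite mxE (negbTE ii') andbF mul0r.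
rewrite big1 ?addr0 // => a' aa'; rewrite big1 // => i' _.
by rewrite mxE (negbTE aa') mul0r.
Qed.

Lemma haar_coef_delta a i l :
  haar_coef (delta_mx a i : V) l = haar R l 0 i *: delta_mx 0 a.
Proof.
apply/rowP => j; rewrite haar_coefE (bigD1 i) //= big1 ?addr0; last first.
  by move=> i' ii'; rewrite mxE (negbTE ii') andbF mul0r.
by rewrite [delta_mx a i _ _]mxE [RHS]mxE [delta_mx 0 a _ _]mxE !eqxx andbT mulrC.
Qed.

Lemma matrix_sum_col s :
  s = \sum_i \sum_a s a i *: delta_mx a i.
Proof. by rewrite exchange_big /=; exact: matrix_sum_delta. Qed.

Lemma obs_sum c : obs c = \sum_i delta_mx (c i) i.
Proof.
apply/matrixP => j i; rewrite mxE summxE (bigD1 i) //= mxE eqxx andbT.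
rewrite big1 ?addr0 1?eq_sym // => i' ii'.
by rewrite mxE (eq_sym i) (negbTE ii') andbF.
Qed.

(** Beyond the order of #|m|, the squared norm of the projected noise has exponential
    tails, uniformly in r. The two budgets of the general bound are
    Q_i(y) = 2 |i-th column of the projection of y|^2, which sum to at most 2|y|^2,
    and dd_i = 2 (sum over m of haar_l(i)^2), which sum to 2 #|m|. *)
Lemma noise_exp_moment m s : prob_columns s ->
  prod_mean (fun i a => s a i) (fun c => expR (energy m (obs c - s) / 32)) <=
    expR (#|m|%:R / 8).
Proof.
move=> [s0 s1].
pose w (i : 'I_n) (a : 'I_r) := s a i.
pose v (i : 'I_n) (a : 'I_r) : V := haar_proj m (delta_mx a i).
pose Q (i : 'I_n) y : R := 2 * \sum_a (haar_proj m y a i) ^+ 2.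
pose dd (i : 'I_n) : R := 2 * \sum_(l in m) haar R l 0 i ^+ 2.
(* 1/32 is the largest scale for which op_bound holds with b = 16: both terms
   16/32^2 and 8 * 2/32^2 equal 1/64. *)
pose A : V -> V := fun x => 32^-1 *: x.
have centered_sumE c : centered_sum w v c = haar_proj m (obs c - s).
  rewrite /centered_sum obs_sum [in RHS](matrix_sum_col s) -sumrB raddf_sum /=.
  apply: eq_bigr => i _; rewrite raddfB /=; congr (_ - _); rewrite raddf_sum /=.
  by apply: eq_bigr => a _; rewrite linearZ.
have AE c : mxdot (centered_sum w v c) (A (centered_sum w v c)) = energy m (obs c - s) / 32.
  by rewrite centered_sumE mxdotZr energyE mulrC.
have ddE : (\sum_i dd i) / 16 = #|m|%:R / 8.
  rewrite /dd -mulr_sumr exchange_big /=.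
  under eq_bigr => l _.
    under eq_bigr do rewrite expr2.
    rewrite -mxdot_rowE haar_orthonormal eqxx; over.
  by rewrite /= sumr_const; field.
have Qsum y : \sum_i Q i y = 2 * energy m y.
  rewrite /Q -mulr_sumr -energyE; congr (_ * _).
  by rewrite exchange_big; apply: eq_bigr => a _; apply: eq_bigr => i _; rewrite expr2.
rewrite -ddE.
have := @quadratic_exp_moment R r n 'I_r n w v Q dd 16 A.
have -> : (fun c => expR (mxdot (centered_sum w v c) (A (centered_sum w v c)))) =
   (fun c => expR (energy m (obs c - s) / 32)).
  by apply/funext => c; rewrite AE.
apply => //.
- by move=> i a; exact: s0.
- split=> [k x y|x y]; rewrite /A.
    by rewrite scalerDr scalerA mulrC -scalerA.
  by rewrite mxdotZl mxdotZr.
- move=> i y; rewrite mulr_ge0 // sumr_ge0 // => a _; exact: sqr_ge0.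
- move=> i a a' y; rewrite /v -linearB /= mxdot_projC mxdotDl mxdotNl !mxdot_delta /Q.
  have [->|aa'] := eqVneq a a'.
    by rewrite subrr expr0n /= mulr_ge0 // sumr_ge0 // => b _; exact: sqr_ge0.
  rewrite (bigD1 a) //= (bigD1 a') 1?eq_sym //=.
  set S := \sum_(_ | _) _; have S0 : 0 <= S by apply: sumr_ge0 => b _; exact: sqr_ge0.
  set u := haar_proj m y a i; set t := haar_proj m y a' i.
  have := sqr_ge0 (u + t); nra.
- move=> i a a'; rewrite /v -linearB /= energyE /energy /dd mulr_sumr.
  apply: ler_sum => l _.
  rewrite haar_coefD haar_coefN !haar_coef_delta -scalerBr mxdotZl mxdotZr.
  rewrite mulrA -expr2 mulrC ler_wpM2r ?sqr_ge0 //.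
  have d1 b : mxdot (delta_mx 0 b : 'rV[R]_r) (delta_mx 0 b) = 1.
    rewrite /mxdot big_ord1 (bigD1 b) //= big1 ?addr0; last first.
      by move=> j jb; rewrite mxE (negbTE jb) mul0r.
    by rewrite mxE !eqxx mul1r.
  have d2 : 0 <= mxdot (delta_mx 0 a : 'rV[R]_r) (delta_mx 0 a').
    rewrite /mxdot; apply: sumr_ge0 => j _; apply: sumr_ge0 => k _.
    by rewrite mulr_ge0 // mxE ler0n.
  rewrite !mxdotE !d1 (mxdotC (delta_mx 0 a')); lra.
- move=> x; rewrite Qsum /A mxdotZl !mxdotZr.
  have := energy_le m (32^-1 *: x); rewrite mxdotZl mxdotZr; lra.
Qed.

End Noise.

(** * Size and number of the models *)

Section Series.
Variable R : realType.

Lemma sum_inv_sqr (K : nat) : \sum_(k < K) (k.+1%:R ^+ 2)^-1 <= 2 :> R.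
Proof.
case: K => [|K]; first by rewrite big_ord0.
suff h : \sum_(k < K.+1) (k.+1%:R ^+ 2)^-1 <= 2 - K.+1%:R^-1 :> R.
  by apply: le_trans h _; rewrite gerBl invr_ge0 ler0n.
elim: K => [|K IH]; first by rewrite big_ord_recr big_ord0 /= add0r expr1n invr1; lra.
rewrite big_ord_recr /=.
apply: le_trans (lerD IH (lexx _)) _.
have x0 : 0 < K.+1%:R :> R by rewrite ltr0n.
have -> : K.+2%:R = K.+1%:R + 1 :> R by rewrite -natr1.
move: (K.+1%:R : R) x0 => x x0.
have -> : 2 - (x + 1)^-1 = 2 - x^-1 + (x * (x + 1))^-1.
  by field; lra.
rewrite lerD2l lef_pV2 ?posrE; nra.
Qed.

Lemma sum_inv_pow2 (K : nat) : \sum_(k < K) ((2 ^ k)%:R)^-1 <= 2 :> R.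
Proof.
suff -> : \sum_(k < K) ((2 ^ k)%:R)^-1 = 2 - 2 / (2 ^ K)%:R :> R.
  by rewrite gerBl divr_ge0 ?ler0n.
elim: K => [|K IH]; first by rewrite big_ord0 expn0; lra.
rewrite big_ord_recr /= IH expnS natrM; field.
by rewrite pnatr_eq0 -lt0n expn_gt0.
Qed.

(** One term of the binomial expansion of (1 + x)^a. *)
Lemma bin_le_expR (a q : nat) (x : R) : 0 <= x ->
  'C(a, q)%:R * x ^+ q <= expR (a%:R * x).
Proof.
move=> x0; apply: (@le_trans _ _ ((1 + x) ^+ a)).
  have [qa|aq] := leqP q a; last by rewrite bin_small // mul0r exprn_ge0 ?addr_ge0.
  rewrite exprDn (bigD1 (Ordinal (qa : (q < a.+1)%N))) //=.
  rewrite expr1n mul1r mulr_natl lerDl sumr_ge0 // => i _.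
  by rewrite mulrn_wge0 // expr1n mul1r exprn_ge0.
rewrite expRM_natl; apply: lerXn2r; rewrite ?nnegrE ?expR_ge0 ?addr_ge0 //.
exact: expR_ge1Dx.
Qed.

End Series.

Section Models.
Variable (N : nat).
Implicit Types (l : Lambda N) (m : {set Lambda N}).

Lemma card_Lambda_level j : (j < N)%N -> #|Lambda_level N j| = (2 ^ j)%N.
Proof.
move=> jN; pose j' : 'I_N := Ordinal jN.
pose f (k : 'I_(2 ^ j)) : Lambda N :=
  Some (Tagged (fun i : 'I_N => 'I_(2 ^ i)) (k : 'I_(2 ^ j'))).
have finj : injective f.
  by move=> k k' /Some_inj /eqP; rewrite eq_Tagged /= => /eqP.
rewrite -[RHS]card_ord -(card_imset predT finj); apply: eq_card => l.
rewrite inE; apply/idP/imsetP.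
  case: l => // -[i k] /= /eqP ij.
  have e : j' = i by apply: val_inj; rewrite /= ij.
  by case: i / e k ij => k _; exists k.
by case=> k _ ->; rewrite /= eqxx.
Qed.

Definition coarse_part J : {set Lambda N} :=
  (Lambda_coarse N :|: \bigcup_(j < J) Lambda_level N j)%SET.

Definition detail_size J k : nat := (2 ^ J %/ k.+1 ^ 3)%N.

(** The choices of coefficients above level J; encoded as finite functions,
    they form a product set, whose cardinality is a product of binomials. *)
Definition detail_families J : pred {ffun 'I_(N - J) -> {set Lambda N}} :=
  family (fun k : 'I_(N - J) =>
    [set B : {set Lambda N} | B \subset Lambda_level N (J + k) &
                              #|B| == detail_size J k]%SET).

Definition NEH_set J (L : {ffun 'I_(N - J) -> {set Lambda N}}) : {set Lambda N} :=
  (coarse_part J :|: \bigcup_(k < N - J) L k)%SET.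

Lemma detail_familiesP J (L : {ffun 'I_(N - J) -> {set Lambda N}}) :
  reflect (forall k, L k \subset Lambda_level N (J + k) /\
                     #|L k| = detail_size J k)
          (L \in @detail_families J).
Proof.
apply: (iffP familyP) => h k.
  by have := h k; rewrite inE => /andP[-> /eqP].
by have [h1 h2] := h k; rewrite inE h1 h2 eqxx.
Qed.

Lemma NEH_modelsP m : NEH_models m <->
  exists (J : 'I_N) (L : {ffun 'I_(N - J) -> {set Lambda N}}),
    L \in @detail_families J /\ m = NEH_set L.
Proof.
split=> [[J [JN [L [hL ->]]]]|[J [L [hL ->]]]].
  exists (Ordinal JN), [ffun k => L k]; split.
    by apply/detail_familiesP => k; rewrite ffunE; exact: hL.
  by congr (_ :|: _)%SET; apply: eq_bigr => k _; rewrite ffunE.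
exists J; split; first exact: ltn_ord.
by exists L; split => // k; exact: (detail_familiesP _ hL).
Qed.

Lemma card_bigcup_le (T I : finType) (P : pred I) (F : I -> {set T}) :
  (#|\bigcup_(i | P i) F i|%SET <= \sum_(i | P i) #|F i|)%N.
Proof.
elim/big_ind2: _ => // [|A x B y hA hB]; first by rewrite cards0.
exact: leq_trans (leq_card_setU _ _) (leq_add hA hB).
Qed.

Lemma card_coarse_part J : (J <= N)%N -> (#|coarse_part J| <= 2 ^ J)%N.
Proof.
move=> JN.
have e : (1 + \sum_(j < J) 2 ^ j = 2 ^ J)%N.
  elim: J {JN} => [|J IH]; first by rewrite big_ord0.
  by rewrite big_ord_recr /= addnA IH expnS mul2n addnn.
rewrite -e (leq_trans (leq_card_setU _ _)) // leq_add ?cards1 //.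
apply: (leq_trans (card_bigcup_le _ _)) => /=.
by apply: leq_sum => j _; rewrite card_Lambda_level // (leq_trans (ltn_ord j)).
Qed.

Lemma detail_size_le (R : realType) J k :
  (detail_size J k)%:R <= (2 ^ J)%:R / k.+1%:R ^+ 3 :> R.
Proof.
rewrite ler_pdivlMr ?exprn_gt0 ?ltr0n // -natrX -natrM ler_nat.
exact: leq_trunc_div.
Qed.

Lemma inv_cube_le (R : realType) (k : nat) : (k.+1%:R ^+ 3)^-1 <= (k.+1%:R ^+ 2)^-1 :> R.
Proof.
by rewrite lef_pV2 ?posrE ?exprn_gt0 ?ltr0n // ler_weXn2l // ler1n.
Qed.

Lemma card_NEH_set_ge (J : 'I_N) (L : {ffun 'I_(N - J) -> {set Lambda N}}) :
  L \in @detail_families J -> (2 ^ J <= #|NEH_set L|)%N.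
Proof.
move=> /detail_familiesP hL.
have k0 : (0 < N - J)%N by rewrite subn_gt0.
have [_ e] := hL (Ordinal k0).
have -> : (2 ^ J = #|L (Ordinal k0)|)%N by rewrite e /detail_size /= exp1n divn1.
apply: subset_leq_card; apply: fintype.subset_trans (finset.subsetUr _ _).
exact: finset.bigcup_sup.
Qed.


Lemma card_NEH_set_leR (R : realType) (J : 'I_N)
    (L : {ffun 'I_(N - J) -> {set Lambda N}}) :
  L \in @detail_families J -> #|NEH_set L|%:R <= 3 * (2 ^ J)%:R :> R.
Proof.
move=> /detail_familiesP hL.
have h1 : (#|NEH_set L| <= 2 ^ J + \sum_(k < N - J) detail_size J k)%N.
  apply: (leq_trans (leq_card_setU _ _)); apply: leq_add.
    by apply: card_coarse_part; exact: ltnW.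
  apply: (leq_trans (card_bigcup_le _ _)); apply: leq_sum => k _.
  by have [_ ->] := hL k.
apply: (@le_trans _ _ (2 ^ J + \sum_(k < N - J) detail_size J k)%:R).
  by rewrite ler_nat.
rewrite natrD natr_sum.
have h2 : \sum_(k < N - J) (detail_size J k)%:R <=
    (2 ^ J)%:R * \sum_(k < N - J) (k.+1%:R ^+ 2)^-1 :> R.
  rewrite mulr_sumr; apply: ler_sum => k _.
  by apply: le_trans (detail_size_le R J k) _; rewrite ler_wpM2l ?ler0n ?inv_cube_le.
have h3 := sum_inv_sqr R (N - J).
have := ler_wpM2l (ler0n R (2 ^ J)) h3; lra.
Qed.

(** There are only exp (O(2^J)) models with J coarse levels, so that a penalty
    proportional to the dimension, without logarithm, pays for all of them. Level
    J + k contributes a binomial coefficient 'C(2^(J+k), q) with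
    q <= 2^J / (k+1)^3, at most exp (5 * 2^J / (k+1)^2). *)
Lemma card_detail_families (R : realType) (J : 'I_N) :
  #|@detail_families J|%:R <= expR (10 * (2 ^ J)%:R) :> R.
Proof.
rewrite card_family foldrE big_map big_enum /= natr_prod.
apply: (@le_trans _ _ (\prod_(k < N - J) expR (5 * (2 ^ J)%:R / k.+1%:R ^+ 2) : R)).
  apply: ler_prod => k _; rewrite ler0n /= cards_draws.
  have JkN : (J + k < N)%N by rewrite -ltn_subRL.
  rewrite card_Lambda_level //.
  (* Any x such that 2^k x <= (k+1)^-3 and -ln x is linear in k would do. *)
  pose x : R := expR (- (4 * k%:R)).
  have x0 : 0 < x by exact: expR_gt0.
  have h := @bin_le_expR R (2 ^ (J + k)) (detail_size J k) x (ltW x0).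
  have e1 : x ^+ detail_size J k * expR (4 * k%:R * (detail_size J k)%:R) = 1.
    by rewrite expRM_natr -exprMn /x -expRD addNr expR0 expr1n.
  apply: (@le_trans _ _ (expR ((2 ^ (J + k))%:R * x + 4 * k%:R * (detail_size J k)%:R))).
    rewrite expRD -[leLHS]mulr1 -[X in _ * X <= _]e1 mulrA ler_wpM2r ?expR_ge0 //.
  rewrite ler_expR.
  have k1 : 0 < k.+1%:R :> R by rewrite ltr0n.
  have hk : k%:R <= k.+1%:R :> R by rewrite ler_nat.
  have hx : (2 ^ k)%:R * x <= (k.+1%:R ^+ 3)^-1.
    have h2 : (2 ^ k)%:R <= expR k%:R :> R.
      have := expR_ge1Dx (1 : R) => h2.
      rewrite -[k%:R]mulr1 expRM_natl natrX; apply: lerXn2r; rewrite ?nnegrE ?expR_ge0 //.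
    apply: (@le_trans _ _ (expR k%:R * x)); first by rewrite ler_wpM2r // ltW.
    rewrite /x -expRD -[leLHS]invrK lef_pV2 ?posrE ?invr_gt0 ?expR_gt0 ?exprn_gt0 //.
    rewrite -expRN.
    have -> : - (k%:R - 4 * k%:R) = 3%:R * k%:R :> R by ring.
    rewrite expRM_natl; apply: lerXn2r; rewrite ?nnegrE ?expR_ge0 ?ler0n //.
    by rewrite -natr1 addrC expR_ge1Dx.
  have hx2 := le_trans hx (inv_cube_le R k).
  have h3 : (2 ^ (J + k))%:R * x <= (2 ^ J)%:R / k.+1%:R ^+ 2.
    by rewrite expnD natrM -mulrA ler_wpM2l.
  have h4 : 4 * k%:R * (detail_size J k)%:R <= 4 * ((2 ^ J)%:R / k.+1%:R ^+ 2) :> R.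
    rewrite -mulrA ler_pM2l //.
    apply: (@le_trans _ _ (k.+1%:R * ((2 ^ J)%:R / k.+1%:R ^+ 3))).
      by apply: ler_pM; rewrite ?ler0n ?detail_size_le.
    suff -> : k.+1%:R * ((2 ^ J)%:R / k.+1%:R ^+ 3) = (2 ^ J)%:R / k.+1%:R ^+ 2 :> R by [].
    by move: (k.+1%:R : R) k1 => y y0; field; rewrite gt_eqF.
  rewrite -(mulrA 5); move: (_ / _) h3 h4 => B h3 h4; lra.
rewrite -expR_sum ler_expR -mulr_sumr.
have h3 := sum_inv_sqr R (N - J).
have := ler_wpM2l (ler0n R (2 ^ J)) h3; lra.
Qed.

(** The factor 11 leaves exp (- 2^J) once the number of models is paid for. *)
Lemma NEH_union_bound (R : realType) :
  \sum_(J < N) \sum_(L in @detail_families J) expR (- (11 * #|NEH_set L|%:R)) <= 2 :> R.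
Proof.
apply: le_trans (sum_inv_pow2 R N); apply: ler_sum => J _.
apply: (@le_trans _ _ (\sum_(L in @detail_families J) expR (- (11 * (2 ^ J)%:R)))).
  apply: ler_sum => L hL.
  by rewrite ler_expR lerN2 ler_pM2l // ler_nat card_NEH_set_ge.
rewrite sumr_const -[leLHS]mulr_natl.
apply: (@le_trans _ _ (expR (10 * (2 ^ J)%:R) * expR (- (11 * (2 ^ J)%:R)))).
  by rewrite ler_wpM2r ?expR_ge0 // card_detail_families.
rewrite -expRD -[leLHS]invrK lef_pV2 ?posrE ?invr_gt0 ?expR_gt0 ?ltr0n ?expn_gt0 //.
rewrite -expRN; set x := (2 ^ J)%:R.
have -> : - (10 * x - 11 * x) = x by ring.
have := expR_ge1Dx x; lra.
Qed.

End Models.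

(** * Oracle inequality *)

Section Oracle.
Variables (R : realType) (r N : nat).
Local Notation n := (2 ^ N)%N.
Local Notation V := 'M[R]_(r, n).
Implicit Types (m : {set Lambda N}) (x y s t d : V).

(** The matrix d has at most the coefficients in m and m', so it only meets the
    noise there; 2ab <= 4a^2 + b^2/4 on each coefficient. *)
Lemma noise_cross_le m m' y d :
  (forall l, l \notin m -> l \notin m' -> haar_coef d l = 0) ->
  2 * mxdot y d <= 4 * energy m y + 4 * energy m' y + mxdot d d / 4.
Proof.
move=> hd; rewrite !parseval /energy !mulr_sumr mulr_suml.
rewrite [X in _ <= X + _ + _]big_mkcond [X in _ <= _ + X + _]big_mkcond.
rewrite -!big_split; apply: ler_sum => l _ /=.
set a := haar_coef y l; set b := haar_coef d l.
have a0 := mxdot_ge0 a; have b0 := mxdot_ge0 b.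
have h : 2 * mxdot a b <= 4 * mxdot a a + mxdot b b / 4.
  have := mxdot_ge0 (2 *: a - 2^-1 *: b).
  rewrite !mxdotE (mxdotC b a); lra.
case: ifPn => lm; case: ifPn => lm'; rewrite ?add0r ?addr0; try lra.
rewrite /b hd // mxdotC !mxdot0l; lra.
Qed.

Lemma contrastE s x t :
  contrast x t = mxdot (t - s) (t - s) - 2 * mxdot (x - s) t - mxdot s s.
Proof.
rewrite /contrast mxnorm_sqr !mxdotE (mxdotC s t); ring.
Qed.

(** Comparing the contrast of the estimator with that of the projection of s on m;
    the cross term between the noise and the error is absorbed in the error. *)
Lemma penalized_error_le (c : R) (est : estimator R r n) x s m :
  is_NEH_estimator c est -> observation x -> NEH_models m ->
  exists2 m', NEH_models m' &
  mxdot (s - est x) (s - est x) <=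
    3 * mxdot (s - haar_proj m s) (s - haar_proj m s) +
    2 * (4 * energy m (x - s) + c * #|m|%:R) +
    2 * (4 * energy m' (x - s) - c * #|m'|%:R).
Proof.
move=> hest hx hm; have [m' [hm' [[tm' _] hmin]]] := hest x hx.
exists m' => //.
set t := est x in tm' hmin *.
set u := haar_proj m s.
have h1 := hmin _ _ hm (haar_proj_is_orth_proj m x).
rewrite !dim_haar_span in h1.
have h2 : contrast x (haar_proj m x) <= contrast x u.
  rewrite /contrast !mxnorm_sqr.
  have := mxdot_ge0 (u - haar_proj m x); rewrite !mxdotE.
  have -> : mxdot x (haar_proj m x) = mxdot (haar_proj m x) (haar_proj m x).
    by rewrite [RHS]mxdot_projC haar_proj_idem.
  have -> : mxdot x u = mxdot (haar_proj m x) u.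
    by rewrite /u mxdot_projC haar_proj_idem.
  rewrite (mxdotC u (haar_proj m x)); lra.
have h3 : 2 * mxdot (x - s) (t - u) <=
    4 * energy m (x - s) + 4 * energy m' (x - s) + mxdot (t - u) (t - u) / 4.
  apply: noise_cross_le => l lm lm'.
  rewrite haar_coefD haar_coefN (haar_span_coef tm' lm') haar_coef_proj.
  by rewrite (negbTE lm) subrr.
have h4 : mxdot (t - u) (t - u) <=
    2 * mxdot (t - s) (t - s) + 2 * mxdot (u - s) (u - s).
  have -> : t - u = (t - s) - (u - s) by rewrite opprB addrA subrK.
  have := mxdot_ge0 ((t - s) + (u - s)).
  move: (t - s) (u - s) => a b.
  rewrite !mxdotE (mxdotC b a); lra.
have e1 : mxdot (s - t) (s - t) = mxdot (t - s) (t - s).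
  by rewrite -opprB mxdotNl mxdotNr opprK.
have e2 : mxdot (s - u) (s - u) = mxdot (u - s) (u - s).
  by rewrite -opprB mxdotNl mxdotNr opprK.
rewrite e1 e2.
move: h1 h2; rewrite !(contrastE s) => h1 h2.
rewrite mxdotDr mxdotNr in h3.
lra.
Qed.

Lemma observation_obs (c : {ffun 'I_n -> 'I_r}) : observation (obs R c).
Proof.
split=> [j i|i]; first by rewrite mxE; case: eqP => _; [right|left].
rewrite (bigD1 (c i)) //= mxE eqxx big1 ?addr0 // => j jc.
by rewrite mxE eq_sym (negbTE jc).
Qed.

(** A bound, valid for all models at once, for the excess of the noise over the
    penalty: u <= 128 exp (u / 128) and a maximum is at most a sum. *)
Definition noise_sup (c : R) y : R :=
  128 * \sum_(J < N) \sum_(L in @detail_families N J)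
    expR (energy (NEH_set L) y / 32 - c / 128 * #|NEH_set L|%:R).

Lemma noise_sup_ge c m y : NEH_models m ->
  4 * energy m y - c * #|m|%:R <= noise_sup c y.
Proof.
move=> /NEH_modelsP [J [L [hL ->]]].
set e := energy _ _; set D := #|_|%:R.
have h : 4 * e - c * D <= 128 * expR (e / 32 - c / 128 * D).
  have := expR_ge1Dx (e / 32 - c / 128 * D); lra.
apply: le_trans h _; rewrite ler_pM2l // (bigD1 J) //= (bigD1 L) //=.
rewrite -addrA lerDl addr_ge0 // sumr_ge0 // => J' _; rewrite ?expR_ge0 //.
by apply: sumr_ge0 => L' _; exact: expR_ge0.
Qed.

(** The constant 1536 = 128 * 12 makes c/128 exceed 11 + 1/8, where 11 pays for the
    number of models and 1/8 for the exponential moment. *)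
Lemma noise_sup_mean c s : 1536 <= c -> prob_columns s ->
  prod_mean (fun i a => s a i) (fun w => noise_sup c (obs R w - s)) <= 256.
Proof.
move=> hc hs; rewrite /noise_sup prod_meanZ prod_mean_sum.
apply: (@le_trans _ _ (128 * 2)); last by lra.
rewrite ler_pM2l //; apply: le_trans (NEH_union_bound N R).
apply: ler_sum => J _; rewrite prod_mean_sum; apply: ler_sum => L hL.
set D := #|_|%:R.
rewrite (_ : (fun w => _) = fun w => expR (- (c / 128 * D)) *
    expR (energy (NEH_set L) (obs R w - s) / 32)); last first.
  by apply/funext => w; rewrite -expRD addrC.
rewrite prod_meanZ.
apply: (@le_trans _ _ (expR (- (c / 128 * D)) * expR (D / 8))).
  by rewrite ler_wpM2l ?expR_ge0 // noise_exp_moment.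
rewrite -expRD ler_expR.
have D0 : 0 <= D by exact: ler0n.
have : 1536 * D <= c * D by rewrite ler_wpM2r.
lra.
Qed.

Lemma oracle_inequality (c : R) (est : estimator R r n) s m :
  1536 <= c -> is_NEH_estimator c est -> prob_columns s -> NEH_models m ->
  prod_mean (fun i a => s a i)
     (fun w => mxdot (s - est (obs R w)) (s - est (obs R w))) <=
  3 * mxdot (s - haar_proj m s) (s - haar_proj m s) + 4 * c * #|m|%:R + 1024.
Proof.
move=> hc hest hs hm; have [s0 s1] := hs.
set B := mxdot (s - haar_proj m s) _.
apply: (@le_trans _ _ (prod_mean (fun i a => s a i)
   (fun w => (3 * B + 4 * c * #|m|%:R) + 4 * noise_sup c (obs R w - s)))).
  apply: ler_prod_mean => [i a|w]; first exact: s0.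
  have [m' hm' h] := penalized_error_le s hest (observation_obs w) hm.
  have h1 := noise_sup_ge c (obs R w - s) hm.
  have h2 := noise_sup_ge c (obs R w - s) hm'.
  rewrite -/B in h; lra.
rewrite prod_meanD prod_mean_cst // prod_meanZ lerD2l.
have := noise_sup_mean hc hs; lra.
Qed.

End Oracle.

(** * Approximation of the Besov bodies *)

Section TopCoefficients.
Variables (R : realType) (T : finType).
Implicit Types (A B : {set T}) (f : T -> R).

(** Greedy choice: a maximal element among the remaining ones is added q times. *)
Lemma top_subset A f (q : nat) : (q <= #|A|)%N ->
  exists B : {set T}, [/\ B \subset A, #|B| = q &
    forall x y, x \in B -> y \in (A :\: B)%SET -> f y <= f x].
Proof.
elim: q => [_|q IH qA].
  by exists finset.set0; rewrite finset.sub0set cards0; split => // x y; rewrite inE.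
have [B [BA cB hB]] := IH (ltnW qA).
have /card_gt0P[z0 hz0] : (0 < #|(A :\: B)%SET|)%N.
  have := cardsD A B; rewrite (finset.setIidPr BA) cB; lia.
case: (arg_maxP f hz0) => z hz zmax.
have : z \in (A :\: B)%SET by exact: hz.
rewrite finset.in_setD => /andP[zB zA].
exists (z |: B)%SET; split.
- by rewrite finset.subUset finset.sub1set zA BA.
- by rewrite cardsU1 zB cB.
move=> x y; rewrite !inE negb_or => /orP[/eqP->|xB] /andP[/andP[yz yB] yA].
  by apply: zmax; apply: (introT setDP _); split.
by apply: hB => //; rewrite inE yB yA.
Qed.

Lemma sqr_powR_split (x p : R) : 0 <= x -> 0 < p ->
  x ^+ 2 = x `^ p * (x `^ p) `^ ((2 - p) / p).
Proof.
move=> x0 p0; have [->|xn0] := eqVneq x 0.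
  by rewrite powR0 ?gt_eqF // mul0r expr0n.
rewrite -powRrM -powRD ?xn0 ?implybT //.
have -> : p + p * ((2 - p) / p) = 2%:R by field; rewrite gt_eqF.
by rewrite powR_mulrn.
Qed.

(** Each value left out is dominated by the #|B| values kept, hence its p-th power
    is at most a / (#|B| + 1); the other factor of f^2 = f^p f^(2-p) sums to at
    most a. *)
Lemma tail_bound A B f (p Q a : R) : 0 < p -> p <= 2 -> (forall x, 0 <= f x) ->
  B \subset A -> (forall x y, x \in B -> y \in (A :\: B)%SET -> f y <= f x) ->
  0 < Q -> Q <= #|B|.+1%:R ->
  \sum_(x in A) f x `^ p <= a ->
  \sum_(x in (A :\: B)%SET) f x ^+ 2 <= a * (a / Q) `^ ((2 - p) / p).
Proof.
move=> p0 p2 f0 BA hB Q0 QB ha.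
have a0 : 0 <= a by apply: le_trans ha; apply: sumr_ge0 => x _; exact: powR_ge0.
have key y : y \in (A :\: B)%SET -> f y `^ p <= a / Q.
  move=> hy; rewrite ler_pdivlMr //.
  move: (hy); rewrite inE => /andP[yB yA].
  apply: (@le_trans _ _ (f y `^ p * #|B|.+1%:R)).
    by rewrite ler_wpM2l ?powR_ge0.
  apply: le_trans ha.
  have yBA : (y |: B)%SET \subset A by rewrite finset.subUset finset.sub1set yA BA.
  apply: (@le_trans _ _ (\sum_(x in (y |: B)%SET) f x `^ p)); last first.
    rewrite [leRHS](big_setID (y |: B)%SET) /= (finset.setIidPr yBA) lerDl.
    by apply: sumr_ge0 => x _; exact: powR_ge0.
  have -> : f y `^ p * #|B|.+1%:R = \sum_(x in (y |: B)%SET) f y `^ p.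
    by rewrite sumr_const cardsU1 yB mulr_natr.
  apply: ler_sum => x; rewrite in_setU1 => /orP[/eqP->//|xB].
  by apply: ge0_ler_powR; rewrite ?nnegrE ?f0 ?hB // ltW.
apply: (@le_trans _ _ (\sum_(x in (A :\: B)%SET)
    f x `^ p * (a / Q) `^ ((2 - p) / p))).
  apply: ler_sum => x hx; rewrite (sqr_powR_split (f0 x) p0).
  rewrite ler_wpM2l ?powR_ge0 //; apply: ge0_ler_powR; rewrite ?nnegrE ?powR_ge0 ?key //.
    by rewrite divr_ge0 ?subr_ge0 // ltW.
  by rewrite divr_ge0 // ltW.
rewrite -mulr_suml ler_wpM2r ?powR_ge0 //; apply: le_trans ha.
rewrite [leRHS](big_setID B) /= lerDr.
by apply: sumr_ge0 => x _; exact: powR_ge0.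
Qed.

End TopCoefficients.

Section Approximation.
Variable R : realType.

Lemma powR2D (x y : R) : 2 `^ (x + y) = 2 `^ x * 2 `^ y :> R.
Proof. by rewrite powRD // pnatr_eq0 implybT. Qed.

Lemma sum_geometric_le (rho : R) (K : nat) : 0 <= rho -> rho < 1 ->
  \sum_(k < K) rho ^+ k <= (1 - rho)^-1.
Proof.
move=> r0 r1; rewrite -[leRHS]div1r ler_pdivlMr ?subr_gt0 //.
suff -> : (\sum_(k < K) rho ^+ k) * (1 - rho) = 1 - rho ^+ K.
  by rewrite gerBl exprn_ge0.
elim: K => [|K IH]; first by rewrite big_ord0 mul0r expr0 subrr.
by rewrite big_ord_recr /= mulrDl IH exprS; ring.
Qed.

(** A power of k+1 is at most a multiple of 2^(om k); this halves the rate of the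
    geometric series and leaves a convergent one. *)
Lemma poly_geometric_bound (om th : R) : 0 < om -> 0 <= th ->
  exists2 K : R, 0 < K & forall M : nat,
   \sum_(k < M) 2 `^ (- (2 * om * k%:R)) * k.+1%:R `^ th <= K.
Proof.
move=> om0 th0.
have ln2 : 0 < ln 2 :> R by rewrite ln_gt0 // ltr1n.
have p2E (x : R) : 2 `^ x = expR (x * ln 2) by rewrite /powR pnatr_eq0.
pose eta := om * ln 2; have eta0 : 0 < eta by rewrite mulr_gt0.
pose T := th + 1; have T0 : 0 < T by rewrite /T; lra.
pose C := (T / eta) `^ T * expR eta.
have C0 : 0 < C by rewrite mulr_gt0 ?expR_gt0 // powR_gt0 // divr_gt0.
have hk (k : nat) : k.+1%:R `^ th <= C * 2 `^ (om * k%:R).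
  apply: (@le_trans _ _ (k.+1%:R `^ T)).
    by apply: ler_powR; rewrite ?ler1n // /T lerDl.
  have h : k.+1%:R <= T / eta * expR (eta / T * k.+1%:R) :> R.
    have h0 := expR_ge1Dx (eta / T * k.+1%:R).
    rewrite mulrC -ler_pdivrMr ?divr_gt0 // invf_div mulrC; lra.
  apply: (@le_trans _ _ ((T / eta * expR (eta / T * k.+1%:R)) `^ T)).
    apply: ge0_ler_powR => //; rewrite ?nnegrE ?ler0n ?(ltW T0) //.
    by rewrite mulr_ge0 ?expR_ge0 // divr_ge0 ?ltW.
  rewrite powRM ?expR_ge0 ?divr_ge0 ?(ltW T0) ?(ltW eta0) // -expRM /C p2E -[leRHS]mulrA -expRD.
  rewrite ler_wpM2l ?powR_ge0 // ler_expR.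
  have -> : eta / T * k.+1%:R * T = eta * k.+1%:R by field; rewrite gt_eqF.
  by rewrite /eta -natr1 le_eqVlt; apply/orP; left; apply/eqP; ring.
pose rho : R := 2 `^ (- om).
have rho0 : 0 < rho by rewrite powR_gt0.
have rho1 : rho < 1 by rewrite /rho p2E expR_lt1 mulNr oppr_lt0.
exists (C / (1 - rho)); first by rewrite divr_gt0 ?subr_gt0.
move=> M; apply: (@le_trans _ _ (\sum_(k < M) C * rho ^+ k)).
  apply: ler_sum => k _.
  apply: (@le_trans _ _ (2 `^ (- (2 * om * k%:R)) * (C * 2 `^ (om * k%:R)))).
    by rewrite ler_wpM2l ?powR_ge0.
  rewrite mulrCA ler_wpM2l ?(ltW C0) // -powR2D.
  rewrite -powR_mulrn ?(ltW rho0) // /rho -powRrM le_eqVlt.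
  by apply/orP; left; apply/eqP; congr (_ `^ _); ring.
by rewrite -mulr_sumr ler_wpM2l ?(ltW C0) // sum_geometric_le // ltW.
Qed.

Lemma detail_size_gt (J k : nat) :
  (2 ^ J)%:R / k.+1%:R ^+ 3 <= (detail_size J k).+1%:R :> R.
Proof.
rewrite ler_pdivrMr ?exprn_gt0 ?ltr0n // -natrX -natrM ler_nat ltnW //.
by rewrite ltn_ceil // expn_gt0.
Qed.

Section OneLevel.
Variables (al p : R).
Hypotheses (p0 : 0 < p) (p2 : p <= 2) (hal : 1 / p - 1 / 2 < al).
Let om := al + 1 / 2 - 1 / p.
Let tau := (2 - p) / p.

(** With a the bound on the p-th powers of the coefficients of level J + k, the tail
    bound there splits into the squared bias E 2^(-2 al J) and a factor that is
    summable in k because om > 0. *)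
Lemma level_tail (E q : R) (J k : nat) : 0 < E -> 0 < q ->
  let a := E `^ (p / 2) * 2 `^ (- ((J + k)%:R * p * om)) in
  a * (a / ((2 ^ J)%:R / q ^+ 3)) `^ tau =
  E * 2 `^ (- (2 * al * J%:R)) * (2 `^ (- (2 * om * k%:R)) * q `^ (3 * tau)).
Proof.
move=> E0 q0 a.
have tau0 : 0 <= tau by rewrite /tau divr_ge0 ?subr_ge0 // ltW.
have a0 : 0 < a by rewrite mulr_gt0 ?powR_gt0.
have q30 : 0 < q ^+ 3 by rewrite exprn_gt0.
have J0 : 0 < (2 ^ J)%:R :> R by rewrite ltr0n expn_gt0.
rewrite invf_div powRM ?(ltW a0) ?divr_ge0 ?(ltW q30) ?(ltW J0) //.
rewrite mulrA (_ : a * a `^ tau = a `^ (1 + tau)); last first.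
  by rewrite powRD ?(gt_eqF a0) ?implybT // powRr1 // ltW.
have -> : 1 + tau = 2 / p by rewrite /tau; field; rewrite gt_eqF.
rewrite /a powRM ?powR_ge0 // -!powRrM.
have -> : p / 2 * (2 / p) = 1 by field; rewrite gt_eqF.
rewrite powRr1 ?(ltW E0) // powRM ?(ltW q30) ?invr_ge0 ?(ltW J0) //.
have -> : (q ^+ 3) `^ tau = q `^ (3 * tau).
  by rewrite [RHS]powRrM powR_mulrn // ltW.
have -> : ((2 ^ J)%:R^-1) `^ tau = 2 `^ (- (J%:R * tau)) :> R.
  by rewrite natrX -powR_mulrn // -powRN -powRrM mulNr.
have e : 2 `^ (- ((J + k)%:R * p * om) * (2 / p)) * 2 `^ (- (J%:R * tau)) =
    2 `^ (- (2 * al * J%:R)) * 2 `^ (- (2 * om * k%:R)) :> R.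
  rewrite -!powR2D; congr (_ `^ _); rewrite /om /tau natrD; field.
  by rewrite gt_eqF.
transitivity (E * (2 `^ (- ((J + k)%:R * p * om) * (2 / p)) * 2 `^ (- (J%:R * tau)))
   * q `^ (3 * tau)); first by ring.
by rewrite e; ring.
Qed.

End OneLevel.

(** Nonlinear approximation: the model keeps everything below level J and the
    2^J / (k+1)^3 largest coefficients of level J + k. *)
Lemma besov_approximation (al p : R) : 0 < p -> p <= 2 -> 1 / p - 1 / 2 < al ->
  exists2 K : R, 0 < K & forall (N r : nat) (rad : R) (s : 'M[R]_(r, 2 ^ N)) (J : nat),
    0 < rad -> besov_class rad al p s -> (J < N)%N ->
    exists m, [/\ NEH_models m, #|m|%:R <= 3 * (2 ^ J)%:R :> R &
      mxdot (s - haar_proj m s) (s - haar_proj m s) <=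
        K * ((2 ^ N)%:R * rad ^+ 2 * 2 `^ (- (2 * al * J%:R)))].
Proof.
move=> p0 p2 hal.
set om := al + 1 / 2 - 1 / p.
have om0 : 0 < om by rewrite /om; lra.
set tau := (2 - p) / p.
have tau0 : 0 <= tau by rewrite /tau divr_ge0 ?subr_ge0 // ltW.
have [K K0 hK] := poly_geometric_bound om0 (mulr_ge0 (ler0n R 3) tau0).
exists K => // N r rad s J rad0 [sprob hs] JN.
pose f l := mxnorm (haar_coef s l).
have f0 l : 0 <= f l by exact: sqrtr_ge0.
pose E : R := (2 ^ N)%:R * rad ^+ 2.
have n0 : 0 < (2 ^ N)%:R :> R by rewrite ltr0n expn_gt0.
have E0 : 0 < E by rewrite mulr_gt0 ?exprn_gt0.
have JkN (k : 'I_(N - J)) : (J + k < N)%N by rewrite -ltn_subRL.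
have hq (k : 'I_(N - J)) : (detail_size J k <= #|Lambda_level N (J + k)|)%N.
  rewrite card_Lambda_level // (leq_trans (leq_div _ _)) //.
  by rewrite leq_exp2l // leq_addr.
have hex (k : 'I_(N - J)) := top_subset f (hq k).
pose L : {ffun 'I_(N - J) -> {set Lambda N}} := [ffun k => sval (cid (hex k))].
have hL k : [/\ L k \subset Lambda_level N (J + k), #|L k| = detail_size J k &
    forall x y, x \in L k -> y \in (Lambda_level N (J + k) :\: L k)%SET -> f y <= f x].
  by rewrite ffunE; case: cid.
have Lfam : L \in @detail_families N J.
  by apply/detail_familiesP => k; have [? ? _] := hL k.
exists (NEH_set L); split.
- by apply/NEH_modelsP; exists (Ordinal JN), L.
- exact: (card_NEH_set_leR R (J := Ordinal JN) Lfam).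
have hlevel (k : 'I_(N - J)) : \sum_(l in Lambda_level N (J + k)) f l `^ p <=
    E `^ (p / 2) * 2 `^ (- ((J + k)%:R * p * om)).
  rewrite powRN ler_pdivlMr ?powR_gt0 // mulrC.
  have -> : E `^ (p / 2) = (2 ^ N)%:R `^ (p / 2) * rad `^ p.
    rewrite powRM ?(ltW n0) ?exprn_ge0 ?(ltW rad0) //; congr (_ * _).
    rewrite -powR_mulrn ?(ltW rad0) // -powRrM; congr (_ `^ _); by field.
  apply: le_trans hs; rewrite (bigD1 (Ordinal (JkN k))) //= lerDl.
  apply: sumr_ge0 => j _; rewrite mulr_ge0 ?powR_ge0 //.
  by apply: sumr_ge0 => l _; exact: powR_ge0.
have htail (k : 'I_(N - J)) :
   \sum_(l in (Lambda_level N (J + k) :\: L k)%SET) f l ^+ 2 <=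
   E * 2 `^ (- (2 * al * J%:R)) * (2 `^ (- (2 * om * k%:R)) * k.+1%:R `^ (3 * tau)).
  have [h1 h2 h3] := hL k.
  rewrite -level_tail ?ltr0n //.
  apply: tail_bound => //.
  by rewrite h2 detail_size_gt.
apply: (@le_trans _ _ (\sum_(k < N - J)
   \sum_(l in (Lambda_level N (J + k) :\: L k)%SET) f l ^+ 2)); last first.
  apply: le_trans (ler_sum _ (fun k _ => htail k)) _.
  rewrite -mulr_sumr mulrC; apply: ler_wpM2r; last exact: hK.
  by rewrite mulr_ge0 ?powR_ge0 ?ltW.
rewrite parseval.
under [leRHS]eq_bigr do rewrite big_mkcond /=.
rewrite [leRHS]exchange_big /=; apply: ler_sum => l _.
have F0 (k : 'I_(N - J)) : 0 <= (if l \in (Lambda_level N (J + k) :\: L k)%SET then f l ^+ 2 else 0).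
  by case: ifP => // _; exact: sqr_ge0.
rewrite haar_coefD haar_coefN haar_coef_proj.
case: ifPn => lm; first by rewrite subrr mxdot0l sumr_ge0.
rewrite subr0.
case: l lm F0 => [u|] lm F0; last by case/negP: lm; rewrite !inE.
have Ju : (J <= val (tag u))%N.
  rewrite leqNgt; apply: contra lm => uJ.
  rewrite !inE; apply/orP; left; apply/orP; right.
  by apply/finset.bigcupP; exists (Ordinal uJ) => //; rewrite inE /=.
have kN : (val (tag u) - J < N - J)%N by rewrite ltn_sub2rE // ltn_ord.
have lk : Some u \in Lambda_level N (J + Ordinal kN) by rewrite inE /= subnKC.
have lL : Some u \notin L (Ordinal kN).
  apply: contra lm => hu; rewrite inE; apply/orP; right.
  by apply/finset.bigcupP; exists (Ordinal kN).
rewrite (bigD1 (Ordinal kN)) //= inE lL lk /= /f mxnorm_sqr lerDl.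
by apply: sumr_ge0 => k _; case: ifP => // _; exact: mxdot_ge0.
Qed.

End Approximation.

(** * Minimax lower bound *)

Section TwoPoint.
Variable R : realType.

(** On u = q/p this is min(1, u) >= u - u^2/4. *)
Lemma min_ge_quad (p q : R) : 0 <= p -> 0 <= q -> (p = 0 -> q = 0) ->
  q - q ^+ 2 / p / 4 <= Num.min p q.
Proof.
move=> p0 q0 h; rewrite le_min; apply/andP; split; last first.
  by rewrite gerBl !divr_ge0 ?sqr_ge0.
have [e|pn0] := eqVneq p 0; first by rewrite e (h e) expr0n /= !mul0r subr0.
have pp : 0 < p by rewrite lt_neqAle eq_sym pn0.
have -> : q - q ^+ 2 / p / 4 = p - (p - q / 2) ^+ 2 / p.
  by field; rewrite pn0.
by rewrite gerBl divr_ge0 ?sqr_ge0.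
Qed.

(** Two simple hypotheses with a small chi-square divergence cannot be told apart:
    the mean of min(p0, p1) is at least 1 - (1/4)(1 + chi2). *)
Lemma two_point_bound n (T : finType) (w0 w1 : 'I_n -> T -> R)
    (L0 L1 : {ffun 'I_n -> T} -> R) (delta : R) :
  (forall i a, 0 <= w0 i a) -> (forall i a, 0 <= w1 i a) ->
  (forall i, \sum_a w1 i a = 1) ->
  (forall i a, w0 i a = 0 -> w1 i a = 0) ->
  0 <= delta -> (forall c, 0 <= L0 c) -> (forall c, 0 <= L1 c) ->
  (forall c, delta <= L0 c + L1 c) ->
  \prod_i \sum_a w1 i a ^+ 2 / w0 i a <= 4 / 3 ->
  delta * (2 / 3) <= prod_mean w0 L0 + prod_mean w1 L1.
Proof.
move=> w00 w10 w1s h01 d0 L00 L10 hL hchi.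
pose p0 (c : {ffun 'I_n -> T}) := \prod_(i < n) w0 i (c i).
pose p1 (c : {ffun 'I_n -> T}) := \prod_(i < n) w1 i (c i).
have p00 c : 0 <= p0 c by exact: prodr_ge0.
have p10 c : 0 <= p1 c by exact: prodr_ge0.
have p01 c : p0 c = 0 -> p1 c = 0.
  move=> /eqP; rewrite prodf_seq_eq0 => /hasP[i _ /= /eqP e].
  by rewrite /p1 (bigD1 i) //= (h01 _ _ e) mul0r.
apply: (@le_trans _ _ (\sum_c delta * (p1 c - p1 c ^+ 2 / p0 c / 4))).
  rewrite -mulr_sumr ler_wpM2l // big_split /= sumrN -mulr_suml.
  have -> : \sum_c p1 c = 1.
    by rewrite /p1 -(bigA_distr_bigA w1) big1.
  have -> : \sum_c p1 c ^+ 2 / p0 c = \prod_i \sum_a w1 i a ^+ 2 / w0 i a.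
    rewrite (bigA_distr_bigA (fun i a => w1 i a ^+ 2 / w0 i a)).
    by apply: eq_bigr => c _; rewrite big_split /= prodrXl prodfV.
  lra.
rewrite /prod_mean -big_split /=; apply: ler_sum => c _.
apply: (@le_trans _ _ (Num.min (p0 c) (p1 c) * (L0 c + L1 c))).
  apply: (@le_trans _ _ (delta * Num.min (p0 c) (p1 c))).
    by rewrite ler_wpM2l // min_ge_quad // => /p01.
  by rewrite mulrC ler_wpM2l // le_min p00 p10.
rewrite -/(p0 c) -/(p1 c) mulrDr; apply: lerD; rewrite ler_wpM2r //.
  by rewrite ge_min lexx.
by rewrite ge_min lexx orbT.
Qed.

Definition flip_at (I : finType) (k : I) (th : {ffun I -> bool}) :
    {ffun I -> bool} :=
  [ffun i => if i == k then ~~ th i else th i].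

(** Pairs the vertices that differ at k only. *)
Lemma sum_flip (I : finType) (k : I) (g : {ffun I -> bool} -> R) :
  \sum_th g th = \sum_(th : {ffun I -> bool} | ~~ th k)
     (g th + g (flip_at k th)).
Proof.
have flipK : involutive (flip_at k).
  by move=> th; apply/ffunP => i; rewrite !ffunE; case: eqP => // _; rewrite negbK.
rewrite (bigID (fun th : {ffun I -> bool} => ~~ th k)) /= big_split /=; congr (_ + _).
rewrite (reindex_inj (inv_inj flipK)) /=.
by apply: eq_bigl => th; rewrite ffunE eqxx negbK.
Qed.

End TwoPoint.

Section Assouad.
Variables (R : realType) (r N : nat).
Local Notation n := (2 ^ N)%N.
Local Notation V := 'M[R]_(r, n).
Variables (a0 a1 : 'I_r) (j0 : 'I_N).
Let amp : R := haar_amp R N j0.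
Let h := half_supp N j0.
Implicit Types th : {ffun 'I_(2 ^ j0) -> bool}.

Lemma block_subproof (i : 'I_n) : ((i %/ h)./2 < 2 ^ j0)%N.
Proof.
rewrite -divn2 -divnMA ltn_divLR ?muln_gt0 ?half_supp_gt0 //.
by have := ltn_ord i; rewrite {2}(half_suppE (ltn_ord j0)) -/h; lia.
Qed.

Definition block (i : 'I_n) : 'I_(2 ^ j0) := Ordinal (block_subproof i).

Definition wavelet_at (k : 'I_(2 ^ j0)) : Lambda N :=
  Some (Tagged (fun j : 'I_N => 'I_(2 ^ j)) k).

Definition height (i : 'I_n) : R := amp * (-1) ^+ (i %/ h).

Lemma haar_wavelet_atE k i : haar R (wavelet_at k) 0 i = (block i == k)%:R * height i.
Proof. by rewrite haar_SomeE /haar_sign /height mulrCA. Qed.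

Lemma height_sqr i : height i ^+ 2 = amp ^+ 2.
Proof. by rewrite /height exprMn sqrr_sign mulr1. Qed.

Lemma sum_block_amp k : \sum_(i | block i == k) amp ^+ 2 = 1.
Proof.
transitivity (mxdot (haar R (wavelet_at k)) (haar R (wavelet_at k))); last first.
  by rewrite haar_orthonormal eqxx.
rewrite mxdot_rowE big_mkcond; apply: eq_bigr => i _ /=.
rewrite haar_wavelet_atE; case: (_ == _); rewrite ?mul0r // mul1r.
by rewrite -[RHS]expr2 height_sqr.
Qed.

Lemma amp_sqr_le1 : amp ^+ 2 <= 1.
Proof.
rewrite /amp haar_amp_sqr ler_pdivrMr ?ltr0n ?expn_gt0 // mul1r ler_nat.
by rewrite leq_exp2l // ltnW.
Qed.

Lemma height_bound i : `|height i| <= 1.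
Proof.
rewrite -(@ler_pXn2r _ 2) ?nnegrE // real_normK ?num_real // expr1n.
by rewrite height_sqr amp_sqr_le1.
Qed.

Definition pair_sign (j : 'I_r) : R := (j == a0)%:R - (j == a1)%:R.
Definition pair_indicator (j : 'I_r) : R := (j == a0)%:R + (j == a1)%:R.

(** Perturbations of the column (1/2, 1/2, 0, ...) by wavelets of level j0, each
    switched on or off by a bit. The coefficient 1/4 keeps the entries
    nonnegative. *)
Definition hypercube (th : {ffun 'I_(2 ^ j0) -> bool}) : V :=
  \matrix_(j, i) (pair_indicator j / 2 + pair_sign j * (height i * (th (block i))%:R / 4)).

Lemma sum_indicator (b : 'I_r) : \sum_(j < r) (j == b)%:R = 1 :> R.
Proof. by rewrite (bigD1 b) //= eqxx big1 ?addr0 // => j /negbTE ->. Qed.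

Lemma hypercube_other th j i : j != a0 -> j != a1 -> hypercube th j i = 0.
Proof.
by move=> /negbTE h0 /negbTE h1; rewrite mxE /pair_indicator /pair_sign h0 h1 /=; field.
Qed.

Hypothesis a01 : a0 != a1.

Lemma hypercube_a0 th i : hypercube th a0 i = 1 / 2 + height i * (th (block i))%:R / 4.
Proof. by rewrite mxE /pair_indicator /pair_sign eqxx (negbTE a01) /=; field. Qed.

Lemma hypercube_a1 th i : hypercube th a1 i = 1 / 2 - height i * (th (block i))%:R / 4.
Proof. by rewrite mxE /pair_indicator /pair_sign eqxx eq_sym (negbTE a01) /=; field. Qed.

Lemma pert_bound th i : `|height i * (th (block i))%:R / 4| <= 1 / 4.
Proof.
have /ler_normlP[h1 h2] := height_bound i.
by apply/ler_normlP; case: (th (block i)); rewrite /= ?mulr1n ?mulr1 ?mulr0; split; lra.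
Qed.

Lemma hypercube_gt0 th i j : j = a0 \/ j = a1 -> 0 < hypercube th j i.
Proof.
have /ler_normlP[h1 h2] := pert_bound th i.
by case=> ->; rewrite ?hypercube_a0 ?hypercube_a1; lra.
Qed.

Lemma hypercube_ge0 th i j : 0 <= hypercube th j i.
Proof.
have [->|j0'] := eqVneq j a0; first by apply/ltW/hypercube_gt0; left.
have [->|j1'] := eqVneq j a1; first by apply/ltW/hypercube_gt0; right.
by rewrite hypercube_other.
Qed.

Lemma hypercube_prob th : prob_columns (hypercube th).
Proof.
split=> [j i|i]; first exact: hypercube_ge0.
under eq_bigr do rewrite mxE.
rewrite big_split /= -!mulr_suml /pair_indicator /pair_sign big_split /= sumrB !sum_indicator; lra.
Qed.

(** The constant part of the hypercube is orthogonal to every wavelet. The sum has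
    at most one term. *)
Lemma haar_coef_hypercube th l : l != None ->
  haar_coef (hypercube th) l =
  \sum_(k | wavelet_at k == l) ((th k)%:R / 4) *: \row_j pair_sign j.
Proof.
move=> lN; apply/rowP => j; rewrite haar_coefE summxE.
have s0 : \sum_(i < n) haar R l 0 i = 0.
  have : mxdot (haar R None) (haar R l) = 0.
    by rewrite haar_orthonormal eq_sym (negbTE lN).
  rewrite mxdot_rowE.
  under eq_bigr => i _ do rewrite [haar R None _ _]mxE.
  rewrite -mulr_sumr => /eqP; rewrite mulf_eq0 => /orP[|/eqP//].
  by rewrite mul1r invr_eq0 sqrtr_eq0 leNgt ltr0n expn_gt0.
transitivity (\sum_(i < n) (pair_indicator j / 2 * haar R l 0 i +
   pair_sign j / 4 * \sum_k (th k)%:R * (haar R (wavelet_at k) 0 i * haar R l 0 i))).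
  apply: eq_bigr => i _; rewrite [hypercube _ _ _]mxE.
  rewrite (bigD1 (block i)) //= big1 ?addr0; last first.
    by move=> k kb; rewrite haar_wavelet_atE eq_sym (negbTE kb) !mul0r mulr0.
  by rewrite haar_wavelet_atE eqxx mul1r; field.
rewrite big_split /= -mulr_sumr s0 mulr0 add0r -mulr_sumr exchange_big /=.
rewrite [RHS]big_mkcond mulr_sumr; apply: eq_bigr => k _ /=.
rewrite -mulr_sumr -mxdot_rowE haar_orthonormal.
case: eqP => _; last by rewrite !mulr0.
by rewrite mxE mxE mulr1; field.
Qed.

Lemma wavelet_at_inj : injective wavelet_at.
Proof. by move=> k k' /Some_inj /eqP; rewrite eq_Tagged => /eqP. Qed.

Lemma mxdot_pair_sign : mxdot (\row_j pair_sign j) (\row_j pair_sign j) = 2.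
Proof.
rewrite /mxdot big_ord1.
transitivity (\sum_(j < r) ((j == a0)%:R + (j == a1)%:R : R)).
  apply: eq_bigr => j _; rewrite !mxE /pair_sign.
  have [->|_] := eqVneq j a0; first by rewrite (negbTE a01) /=; ring.
  by case: (_ == _) => /=; ring.
by rewrite big_split /= !sum_indicator.
Qed.

Lemma hypercube_coef_le th l : l != None -> mxnorm (haar_coef (hypercube th) l) <= 1.
Proof.
move=> lN; rewrite haar_coef_hypercube //.
have [/existsP[k /eqP e]|nk] := boolP [exists k, wavelet_at k == l].
  rewrite (bigD1 k) ?e //= big1 ?addr0; last first.
    by move=> k' /andP[/eqP e' kk]; case/eqP: kk; apply: wavelet_at_inj; rewrite e.
  rewrite -(@ler_pXn2r _ 2) ?nnegrE ?sqrtr_ge0 // mxnorm_sqr expr1n.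
  by rewrite mxdotZl mxdotZr mxdot_pair_sign; case: (th k) => /=; lra.
rewrite big1 => [|k e]; last by case/negP: nk; apply/existsP; exists k.
by rewrite /mxnorm mxdot0l sqrtr0.
Qed.

Lemma hypercube_coef0 th (j : 'I_N) l : j != j0 -> l \in Lambda_level N j ->
  haar_coef (hypercube th) l = 0.
Proof.
move=> jj hl; have lN : l != None by move: hl; rewrite inE; case: l.
rewrite haar_coef_hypercube // big1 // => k /eqP e.
move: hl; rewrite -e inE /= => /eqP e'.
by case/eqP: jj; apply: val_inj; rewrite /= e'.
Qed.


(** Apart from the coarse one there are at most 2^j0 nonzero coefficients, of norm at
    most 1 and all on level j0: the hypothesis on
    j0 is what the definition of the Besov body then requires. *)
Lemma hypercube_besov (al p rad : R) th : 0 < p -> 0 < rad ->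
  2 `^ ((1 + 2 * al) * j0%:R) <= (2 ^ N)%:R * rad ^+ 2 ->
  besov_class rad al p (hypercube th).
Proof.
move=> p0 rad0 hJ; split; first exact: hypercube_prob.
have n0 : 0 < (2 ^ N)%:R :> R by rewrite ltr0n expn_gt0.
rewrite (bigD1 j0) //= [X in _ + X]big1 ?addr0; last first.
  move=> j jj; rewrite big1 ?mulr0 // => l hl.
  rewrite (hypercube_coef0 _ jj hl) /mxnorm mxdot0l sqrtr0.
  by rewrite powR0 // gt_eqF.
have -> : (2 ^ N)%:R `^ (p / 2) * rad `^ p = ((2 ^ N)%:R * rad ^+ 2) `^ (p / 2).
  rewrite powRM ?(ltW n0) ?exprn_ge0 ?(ltW rad0) //; congr (_ * _).
  rewrite -powR_mulrn ?(ltW rad0) // -powRrM; congr (_ `^ _).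
  by field.
apply: (@le_trans _ _ ((2 `^ ((1 + 2 * al) * j0%:R)) `^ (p / 2))); last first.
  apply: ge0_ler_powR => //; rewrite ?nnegrE ?powR_ge0 //.
    by rewrite divr_ge0 // ltW.
  by rewrite mulr_ge0 ?exprn_ge0 // ltW.
apply: (@le_trans _ _ (2 `^ (j0%:R * p * (al + 1 / 2 - 1 / p)) * (2 ^ j0)%:R)).
  rewrite ler_wpM2l ?powR_ge0 // -(card_Lambda_level (ltn_ord j0)).
  rewrite -sum1_card natr_sum; apply: ler_sum => l hl.
  have lN : l != None by move: hl; rewrite inE; case: l.
  apply: (@le_trans _ _ (1 `^ p)); last by rewrite powR1.
  apply: ge0_ler_powR; rewrite ?nnegrE ?(ltW p0) ?sqrtr_ge0 //.
  exact: hypercube_coef_le.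
rewrite natrX -powR_mulrn // -powRrM -powRD; last by rewrite pnatr_eq0 implybT.
rewrite le_eqVlt; apply/orP; left; apply/eqP; congr (_ `^ _); field.
by rewrite gt_eqF.
Qed.

Section Estimator.
Variable est : estimator R r n.

(** The part of the loss on the line a0 that depends on the bit k only. *)
Definition block_loss (k : 'I_(2 ^ j0)) (b : bool) (c : {ffun 'I_n -> 'I_r}) : R :=
  \sum_(i | block i == k) (1 / 2 + height i * b%:R / 4 - est (obs R c) a0 i) ^+ 2.

Lemma block_loss_ge0 k b c : 0 <= block_loss k b c.
Proof. by apply: sumr_ge0 => i _; exact: sqr_ge0. Qed.

Lemma sum_block_loss_le th c :
  \sum_k block_loss k (th k) c <=
  mxdot (hypercube th - est (obs R c)) (hypercube th - est (obs R c)).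
Proof.
rewrite [leRHS]/mxdot (bigD1 a0) //=.
apply: (@le_trans _ _ (\sum_(i < n) (hypercube th - est (obs R c)) a0 i ^+ 2)).
  rewrite (partition_big block xpredT) //=; apply: ler_sum => k _.
  apply: ler_sum => i /eqP e.
  by rewrite [X in _ <= X ^+ 2]mxE [X in _ <= (_ + X) ^+ 2]mxE hypercube_a0 e.
apply: ler_wpDr; last by apply: ler_sum => i _; rewrite expr2.
by apply: sumr_ge0 => j _; apply: sumr_ge0 => i _; rewrite -expr2 sqr_ge0.
Qed.

Lemma block_loss_pair k c : 1 / 32 <= block_loss k false c + block_loss k true c.
Proof.
rewrite /block_loss -big_split /=.
apply: (@le_trans _ _ (\sum_(i | block i == k) amp ^+ 2 / 32)).
  by rewrite -mulr_suml sum_block_amp.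
apply: ler_sum => i _; rewrite -(height_sqr i) /=.
set t := est _ _ _; move: (height i) t => x t.
have := sqr_ge0 (2 * (1 / 2 - t) + x / 4); rewrite ?mulr0n ?mulr1n; nra.
Qed.

(** Only the columns of block k see the flip; there the two entries 1/2 become
    1/2 + x and 1/2 - x with 16 x^2 = amp^2. *)
Lemma chi2_factor th k (i : 'I_n) : ~~ th k ->
  \sum_a hypercube (flip_at k th) a i ^+ 2 / hypercube th a i <=
  expR (if block i == k then amp ^+ 2 / 4 else 0).
Proof.
move=> thk; set th' := flip_at k th; case: eqP => [e|ne].
  rewrite (bigD1 a0) //= (bigD1 a1) 1?eq_sym //= big1 ?addr0; last first.
    by move=> a /andP[h0 h1]; rewrite hypercube_other // expr0n mul0r.
  rewrite !hypercube_a0 !hypercube_a1 e /th' ffunE eqxx (negbTE thk) /=.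
  rewrite -(height_sqr i); apply: le_trans (expR_ge1Dx _).
  rewrite mulr0 mul0r addr0 subr0 mulr1.
  rewrite le_eqVlt; apply/orP; left; apply/eqP; by field.
rewrite expR0 -[leRHS](proj2 (hypercube_prob th) i).
apply: ler_sum => a _.
have -> : hypercube th' a i = hypercube th a i.
  by rewrite !mxE /th' ffunE; case: eqP ne.
rewrite expr2; have [->|h0] := eqVneq (hypercube th a i) 0; first by rewrite !mul0r.
by rewrite mulfK.
Qed.

Lemma expR_quarter : expR (1 / 4) <= 4 / 3 :> R.
Proof.
have := expR_ge1Dx (- (1 / 4) : R).
by rewrite expRN -[leRHS]mul1r ler_pdivlMr ?expR_gt0 //; lra.
Qed.

Lemma flip_bound th k : ~~ th k ->
  1 / 48 <= prod_mean (fun i a => hypercube th a i) (block_loss k (th k)) +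
    prod_mean (fun i a => hypercube (flip_at k th) a i) (block_loss k (flip_at k th k)).
Proof.
move=> thk; set th' := flip_at k th; have [_ s1] := hypercube_prob th'.
rewrite [th' k]ffunE eqxx (negbTE thk) /=.
have -> : 1 / 48 = 1 / 32 * (2 / 3) :> R by lra.
apply: two_point_bound.
- by move=> i a; exact: hypercube_ge0.
- by move=> i a; exact: hypercube_ge0.
- by move=> i; exact: s1.
- move=> i a h0; apply: hypercube_other.
    by apply/eqP => e; have := hypercube_gt0 th i (or_introl e); rewrite h0 ltxx.
  by apply/eqP => e; have := hypercube_gt0 th i (or_intror e); rewrite h0 ltxx.
- by [].
- by move=> c; exact: block_loss_ge0.
- by move=> c; exact: block_loss_ge0.
- by move=> c; exact: block_loss_pair.
apply: (@le_trans _ _ (\prod_(i < n) expR (if block i == k then amp ^+ 2 / 4 else 0))).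
  apply: ler_prod => i _; rewrite chi2_factor // andbT.
  by apply: sumr_ge0 => a _; rewrite divr_ge0 ?sqr_ge0 ?hypercube_ge0.
rewrite -expR_sum -big_mkcond /= -mulr_suml sum_block_amp.
exact: expR_quarter.
Qed.

(** Assouad's argument: the risk averaged over the hypercube is at least the sum
    over the bits of the loss on a random bit, and a bit cannot be recovered. *)
Lemma assouad (M : R) :
  (forall th, prod_mean (fun i a => hypercube th a i)
     (fun c => mxdot (hypercube th - est (obs R c)) (hypercube th - est (obs R c))) <= M) ->
  (2 ^ j0)%:R / 96 <= M.
Proof.
move=> hM.
pose K : R := #|{ffun 'I_(2 ^ j0) -> bool}|%:R.
have K0 : 0 < K by rewrite ltr0n; apply/card_gt0P; exists [ffun=> true].
have half (k : 'I_(2 ^ j0)) :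
    \sum_(th : {ffun 'I_(2 ^ j0) -> bool} | ~~ th k) 1 = K / 2.
  have := sum_flip k (fun=> 1 : R); rewrite big_split /=.
  have -> : \sum_(th : {ffun 'I_(2 ^ j0) -> bool}) (1 : R) = K by rewrite sumr_const.
  lra.
rewrite -(ler_pM2l K0).
have -> : K * M = \sum_(th : {ffun 'I_(2 ^ j0) -> bool}) M.
  by rewrite sumr_const mulr_natl.
apply: le_trans (ler_sum _ (fun th _ => hM th)).
apply: (@le_trans _ _ (\sum_th \sum_k
   prod_mean (fun i a => hypercube th a i) (block_loss k (th k)))); last first.
  apply: ler_sum => th _; rewrite -prod_mean_sum; apply: ler_prod_mean.
    by move=> i a; exact: hypercube_ge0.
  by move=> c; exact: sum_block_loss_le.
rewrite exchange_big /=.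
apply: (@le_trans _ _ (\sum_(k < 2 ^ j0) K / 2 * (1 / 48))).
  rewrite sumr_const card_ord -[leRHS]mulr_natr; lra.
apply: ler_sum => k _; rewrite (sum_flip k) -(half k) mulr_suml.
by apply: ler_sum => th thk; rewrite mul1r; exact: flip_bound.
Qed.

End Estimator.

End Assouad.

(** * From the probability space to finite sums *)

Section FiniteRisk.
Variables (R : realType) (r N : nat).
Local Notation n := (2 ^ N)%N.
Variables (d : measure_display) (Omega : measurableType d).
Variables (P : probability Omega R) (X : Omega -> 'M[R]_(r, n)) (s : 'M[R]_(r, n)).
Hypothesis hX : multinomial_model P X s.

(** A column of nonnegative entries with sum one has at most one entry equal to one. *)
Lemma observation_eq (x : 'M[R]_(r, n)) (c : {ffun 'I_n -> 'I_r}) :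
  observation x -> (forall i, x (c i) i = 1) -> x = obs R c.
Proof.
move=> [x01 xs] hc; apply/matrixP => j i; rewrite mxE.
have [e|ne] := eqVneq (c i) j; first by rewrite -e hc.
have x0 j' : 0 <= x j' i by case: (x01 j' i) => ->.
case: (x01 j i) => // xj; have := xs i.
rewrite (bigD1 (c i)) //= (bigD1 j) 1?eq_sym //= hc xj.
have : 0 <= \sum_(k < r | (k != c i) && (k != j)) x k i by apply: sumr_ge0.
lra.
Qed.

Lemma observation_ex (x : 'M[R]_(r, n)) : observation x ->
  exists c : {ffun 'I_n -> 'I_r}, x = obs R c.
Proof.
move=> hx; have [x01 xs] := hx.
have h i : exists j, x j i = 1.
  have [/existsP[j /eqP e]|nk] := boolP [exists j, x j i == 1]; first by exists j.
  have := xs i; rewrite big1 => [/esym/eqP|j _]; first by rewrite oner_eq0.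
  case: (x01 j i) => // e; case/negP: nk; apply/existsP; exists j; exact/eqP.
exists [ffun i => sval (cid (h i))]; apply: observation_eq => // i.
by rewrite ffunE; case: cid.
Qed.

Lemma obs_inj : injective (@obs R r N).
Proof.
move=> c c' e; apply/ffunP => i.
have : obs R c' (c i) i = 1 by rewrite -e mxE eqxx.
rewrite mxE; case: eqP => // _ /esym/eqP; by rewrite oner_eq0.
Qed.

Lemma entry_measurable j i : measurable [set w | X w j i = 1].
Proof.
have := model_measurable hX j i measurableT (measurable_set1 1).
by rewrite setTI.
Qed.

Lemma entry_prob j i : P [set w | X w j i = 1] = (s j i)%:E.
Proof.
rewrite -(model_mean hX) -expectation_indic; last exact: entry_measurable.
congr expectation; apply/funext => w; rewrite indicE.
case: (proj1 (model_values hX w) j i) => e; rewrite e.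
  rewrite memNset //= e => /esym/eqP; by rewrite oner_eq0.
by rewrite mem_set.
Qed.

Definition cell (c : {ffun 'I_n -> 'I_r}) : set Omega := [set w | X w = obs R c].

Lemma cellE c : cell c = [set w | forall i, X w (c i) i = 1].
Proof.
apply/seteqP; split=> w /=; first by rewrite /cell /= => -> i; rewrite mxE eqxx.
by move=> h; apply: observation_eq => //; exact: model_values hX w.
Qed.

Lemma cell_measurable c : measurable (cell c).
Proof.
rewrite cellE.
have -> : [set w | forall i, X w (c i) i = 1] =
    \bigcap_(i in [set: 'I_n]) [set w | X w (c i) i = 1].
  by apply/seteqP; split=> w /= h i; [move=> _; exact: h|exact: h].
apply: fin_bigcap_measurable; first exact: finite_finset.
by move=> i _; exact: entry_measurable.
Qed.

Lemma cell_prob c : P (cell c) = (\prod_(i < n) s (c i) i)%:E.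
Proof.
have := model_independent hX (fun i => [set v : 'cV[R]_r | v (c i) 0 = 1]).
have -> : [set w | forall i, [set v : 'cV[R]_r | v (c i) 0 = 1] (col i (X w))] = cell c.
  rewrite cellE; apply/seteqP; split=> w /= h i; first by have := h i; rewrite mxE.
  by rewrite mxE.
move=> ->.
rewrite (big_morph EFin (@EFinM R) erefl); apply: eq_bigr => i _.
rewrite -entry_prob; congr (P _).
by apply/seteqP; split=> w /=; rewrite mxE.
Qed.

(** X takes finitely many values, and the probability of each is a product by
    independence; an entry of X is an indicator, so its mean is a probability. *)
Lemma risk_prod_mean (est : estimator R r n) : risk P X s est =
  (prod_mean (fun i a => s a i)
     (fun c => mxdot (s - est (obs R c)) (s - est (obs R c))))%:E.
Proof.
rewrite /risk unlock.
pose g (c : {ffun 'I_n -> 'I_r}) := mxdot (s - est (obs R c)) (s - est (obs R c)).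
have g0 c : 0 <= g c by exact: mxdot_ge0.
transitivity (\int[P]_w (\sum_c (g c * \1_(cell c) w)%:E)%E)%E.
  apply: eq_integral => w _; have [c e] := observation_ex (model_values hX w).
  rewrite sumEFin; congr EFin; rewrite mxnorm_sqr (bigD1 c) //= big1 ?addr0.
    by rewrite indicE mem_set //= mulr1 e.
  move=> c' cc'; rewrite indicE memNset ?mulr0 // /cell /= e => /obs_inj e'.
  by rewrite e' eqxx in cc'.
have mf c : measurable_fun setT (fun w => g c * \1_(cell c) w).
  apply: measurable_funM => //.
  by apply: measurable_indic; exact: cell_measurable.
rewrite ge0_integral_sum //; last 2 first.
- by move=> c; apply/measurable_EFinP; exact: mf.
- by move=> c w _; rewrite lee_fin mulr_ge0.
rewrite /prod_mean -sumEFin; apply: eq_bigr => c _.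
rewrite (@integralZl_indic _ _ _ P setT measurableT (fun=> cell c)) //.
- rewrite integral_indic //; last exact: cell_measurable.
  rewrite setIT; transitivity ((g c)%:E * P (cell c))%E; first by [].
  by rewrite cell_prob -EFinM mulrC.
- by move=> gc; have := g0 c; rewrite leNgt gc.
- exact: cell_measurable.
Qed.

End FiniteRisk.

(** * Matching rates *)

Section Rates.
Variable R : realType.

(** The level at which the squared bias E 2^(-2 al J) and the variance 2^J
    balance. *)
Lemma balanced_level (al E : R) (N : nat) : 0 < 1 + 2 * al -> 1 <= E ->
  E < 2 `^ ((1 + 2 * al) * N%:R) ->
  exists J, [/\ (J < N)%N, 2 `^ ((1 + 2 * al) * J%:R) <= E &
    E < 2 `^ ((1 + 2 * al) * J.+1%:R)].
Proof.
move=> al0 E1; elim: N => [|N IH].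
  by rewrite mulr0 powRr0 ltNge E1.
move=> hN; have [h|h] := leP (2 `^ ((1 + 2 * al) * N%:R)) E; first by exists N.
by have [J [J1 J2 J3]] := IH h; exists J; split => //; exact: ltnW.
Qed.

Variables (r N : nat) (d : measure_display) (Omega : measurableType d).
Local Notation n := (2 ^ N)%N.
Variables (P : 'M[R]_(r, n) -> probability Omega R) (X : Omega -> 'M[R]_(r, n)).
Hypothesis hX : forall s, prob_columns s -> multinomial_model (P s) X s.

Lemma minimax_lower_bound (al p rad : R) (J : nat) :
  (2 <= r)%N -> 0 < p -> 0 < rad -> (J < N)%N ->
  2 `^ ((1 + 2 * al) * J%:R) <= n%:R * rad ^+ 2 ->
  (((2 ^ J)%:R / 96)%:E <= minimax_risk P X (@besov_class R r N rad al p))%E.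
Proof.
move=> r2 p0 rad0 JN hJ.
pose a0 : 'I_r := Ordinal (leq_trans (isT : (0 < 2)%N) r2).
pose a1 : 'I_r := Ordinal (leq_trans (isT : (1 < 2)%N) r2).
have a01 : a0 != a1 by [].
pose j0 : 'I_N := Ordinal JN.
apply: le_ereal_inf_tmp => _ /= [est _ <-].
have hr (th : {ffun 'I_(2 ^ j0) -> bool}) : ((prod_mean (fun i a => hypercube R a0 a1 th a i)
    (fun c => mxdot (hypercube R a0 a1 th - est (obs R c))
                    (hypercube R a0 a1 th - est (obs R c))))%:E <=
    max_risk P X (@besov_class R r N rad al p) est)%E.
  rewrite -(risk_prod_mean (hX (hypercube_prob R a01 th))).
  apply: ereal_sup_ubound; exists (hypercube R a0 a1 th) => //.
  exact: hypercube_besov.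
move: hr; case: (max_risk _ _ _ _) => [M| |] hr.
- rewrite lee_fin; apply: (assouad (j0 := j0) a01 (est := est)) => th.
  by rewrite -lee_fin.
- by rewrite leey.
- by have := hr [ffun=> true]; rewrite leNgt ltNyr.
Qed.

Lemma NEH_upper_bound (c al p rad K : R) (J : nat) (est : estimator R r n) :
  0 < K -> 1536 <= c -> (J < N)%N -> is_NEH_estimator c est ->
  n%:R * rad ^+ 2 <= 2 `^ ((1 + 2 * al) * J.+1%:R) ->
  (forall s : 'M[R]_(r, n), besov_class rad al p s -> exists m : {set Lambda N},
     [/\ NEH_models m, #|m|%:R <= 3 * (2 ^ J)%:R :> R &
      mxdot (s - haar_proj m s) (s - haar_proj m s) <=
        K * (n%:R * rad ^+ 2 * 2 `^ (- (2 * al * J%:R)))]) ->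
  (max_risk P X (@besov_class R r N rad al p) est <=
     ((3 * K * 2 `^ (1 + 2 * al) + 12 * c + 1024) * (2 ^ J)%:R)%:E)%E.
Proof.
move=> K0 hc JN hest hJ happ; apply: ge_ereal_sup => _ /= [s hs <-].
have sp : prob_columns s by case: hs.
rewrite (risk_prod_mean (hX sp)) lee_fin.
have [m [hm cm hb]] := happ s hs.
apply: le_trans (oracle_inequality hc hest sp hm) _.
set B := mxdot _ _ in hb *.
have J1 : 1 <= (2 ^ J)%:R :> R by rewrite ler1n expn_gt0.
have hE : n%:R * rad ^+ 2 * 2 `^ (- (2 * al * J%:R)) <= 2 `^ (1 + 2 * al) * (2 ^ J)%:R.
  apply: (@le_trans _ _ (2 `^ ((1 + 2 * al) * J.+1%:R) * 2 `^ (- (2 * al * J%:R)))).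
    by rewrite ler_wpM2r ?powR_ge0.
  rewrite natrX -powR_mulrn // -!powR2D le_eqVlt; apply/orP; left; apply/eqP.
  by congr (_ `^ _); rewrite -natr1; ring.
have hb' : B <= K * (2 `^ (1 + 2 * al) * (2 ^ J)%:R).
  by apply: le_trans hb _; rewrite ler_pM2l.
have hcm : c * #|m|%:R <= c * (3 * (2 ^ J)%:R).
  by rewrite ler_wpM2l //; lra.
lra.
Qed.

End Rates.

Theorem corollary4 (R : realType) :
  exists kappa : R, 0 < kappa /\
  forall c p alpha : R,
    kappa <= c -> 0 < p -> p <= 2 -> 1 / p - 1 / 2 < alpha ->
  exists C : R, 0 < C /\
  forall (N r : nat) (rad : R),
    (1 <= N)%N -> (2 <= r)%N -> 0 < rad ->
    rad < (2 ^ N)%:R `^ alpha -> 1 <= (2 ^ N)%:R * rad ^+ 2 ->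
  forall (d : measure_display) (Omega : measurableType d)
    (P : 'M[R]_(r, 2 ^ N) -> probability Omega R)
    (X : Omega -> 'M[R]_(r, 2 ^ N)),
    (forall s, prob_columns s -> multinomial_model (P s) X s) ->
  forall s_tilde : estimator R r (2 ^ N),
    is_NEH_estimator c s_tilde ->
    (max_risk P X (@besov_class R r N rad alpha p) s_tilde
     <= C%:E * minimax_risk P X (@besov_class R r N rad alpha p))%E.
Proof.
exists 1536; split; first by rewrite ltr0n.
move=> c p al hc p0 p2 hal.
have [K K0 happ] := besov_approximation p0 p2 hal.
pose U := 3 * K * 2 `^ (1 + 2 * al) + 12 * c + 1024.
have U0 : 0 < U.
  rewrite /U; have : 0 < K * 2 `^ (1 + 2 * al) by rewrite mulr_gt0 ?powR_gt0.
  lra.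
(* The risk of the estimator is at most U 2^J, and no estimator does better than
   2^J / 96. *)
exists (96 * U); split; first by rewrite mulr_gt0.
move=> N r rad N1 r2 rad0 hrad hnR d Omega P X hX est hest.
have al0 : 0 < al.
  have : 1 / 2 <= 1 / p by rewrite !div1r lef_pV2 ?posrE.
  lra.
have hE : (2 ^ N)%:R * rad ^+ 2 < 2 `^ ((1 + 2 * al) * N%:R).
  have n0 : 0 < (2 ^ N)%:R :> R by rewrite ltr0n expn_gt0.
  apply: (@lt_le_trans _ _ ((2 ^ N)%:R * ((2 ^ N)%:R `^ al) ^+ 2)).
    by rewrite ltr_pM2l // ltr_pXn2r // ?nnegrE ?powR_ge0 ?ltW.
  rewrite -powR_mulrn ?powR_ge0 // natrX -powR_mulrn // -!powRrM -powR2D.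
  by rewrite le_eqVlt; apply/orP; left; apply/eqP; congr (_ `^ _); ring.
have al1 : 0 < 1 + 2 * al by lra.
have [J [JN J1 J2]] := balanced_level al1 hnR hE.
have hup := NEH_upper_bound hX K0 hc JN hest (ltW J2)
  (fun s hs => happ N r rad s J rad0 hs JN).
apply: le_trans hup _; rewrite -/U.
have -> : U * (2 ^ J)%:R = 96 * U * ((2 ^ J)%:R / 96) by field.
rewrite EFinM; apply: lee_wpmul2l; first by rewrite lee_fin mulr_ge0 // ltW.
exact: minimax_lower_bound.
Qed.
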